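(* For a holomorphic family of Axiom A polynomial skew products of $\mathbb{C}^2$, the holomorphic motion of $J_2$ preserves the vertical fibration, inducing a holomorphic motion of each fiber Julia set $J_z=J_2\cap(\{z\}\times\mathbb{C})$.
   Context: A polynomial skew product of $\mathbb{C}^2$ is a map $f(z,w)=(p(z),q(z,w))$, with $p,q$ polynomials, that extends holomorphically to an endomorphism of $\mathbb{P}^2$ of degree $d\ge 2$ (so $p$ and $q$ both have degree $d$). Write $q_z(w)=q(z,w)$ and $Q_z^n=q_{p^{n-1}(z)}\circ\cdots\circ q_{p(z)}\circ q_z$. $K_p$ and $J_p=\partial K_p$ are the filled Julia set and Julia set of $p$; $A_p$ is the finite set of attracting periodic points of $p$ in $\mathbb{C}$. $K=\{x\in\mathbb{C}^2:\sup_n\|f^n(x)\|<\infty\}$, $K_z=K\cap(\{z\}\times\mathbb{C})$, $J_z=\partial K_z$ (boundary in $\{z\}\times\mathbb{C}$), and $J_2=\overline{\bigcup_{z\in J_p}J_z}$. When $f$ is Axiom A, $J_2=\bigcup_{z\in J_p}J_z$, so that $J_z=J_2\cap(\{z\}\times\mathbb{C})$ for $z\in J_p$. The vertical fibration is the family of vertical lines $\{z\}\times\mathbb{C}$. Vertical expansion: for a compact $Z\subseteq K_p$ with $p(Z)\subseteq Z$, $f$ is vertically expanding over $Z$ if there are $c>0$, $L>1$ with $|(Q_z^n)'(w)|\ge cL^n$ for all $z\in Z$, $w\in J_z$, $n\ge1$. Axiom A: (by a characterization of Jonsson, used as the definition) $f$ is Axiom A on $\mathbb{C}^2$ iff (i)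 $p$ is hyperbolic (expanding on $J_p$), (ii) $f$ is vertically expanding over $J_p$, and (iii) $f$ is vertically expanding over $A_p$. $D(a,r)$ is the disk in $\mathbb{C}$ of center $a$ and radius $r$. A holomorphic family is a family $\{f_\lambda=(p_\lambda,q_\lambda):\lambda\in D(0,1)\}$ of polynomial skew products such that the coefficients of $p_\lambda$ and $q_\lambda$ are holomorphic in $\lambda$. For a subset $E$ of a complex manifold $X$, a map $\Phi:D(0,r)\times E\to X$ is a holomorphic motion of $E$ if $\Phi$ is continuous, $\Phi(0,e)=e$ for all $e\in E$, $\Phi(\cdot,e)$ is holomorphic for each fixed $e\in E$, and $\Phi_\lambda:=\Phi(\lambda,\cdot)$ is injective for each fixed $\lambda\in D(0,r)$. ''The holomorphic motion of $J_2$'' is the one supplied by a theorem of Jonsson: for a holomorphic family of Axiom A polynomial skew products there exist $r>0$ and a holomorphic motion $\Phi:D(0,r)\times J_2(f_0)\to\mathbb{C}^2$ such that $\Phi_\lambda(J_2(f_0))=J_2(f_\lambda)$ and $f_\lambda=\Phi_\lambda\circ f_0\circ\Phi_\lambda^{-1}$ on $J_2(f_\lambda)$ for all $\lambda\in D(0,r)$. *)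

(* Defs.v *)
From HB Require Import structures.
From mathcomp Require Import all_boot all_order all_algebra.
From mathcomp Require Import complex.
From mathcomp Require Import all_classical all_reals all_analysis.

Set Implicit Arguments.
Unset Strict Implicit.
Unset Printing Implicit Defensive.

Import Order.TTheory GRing.Theory Num.Theory.
Import numFieldNormedType.Exports.

Local Open Scope classical_set_scope.
Local Open Scope ring_scope.

(* The complex numbers over R, as a bundled numClosedFieldType, so that the
   library's norm topology and its normed module structure over itself apply.
   Norms are elements of [cplx R]; they are compared with reals through the
   injection [toC]. *)
Definition cplx (R : realType) : numClosedFieldType := R[i].
Arguments cplx : simpl never.

Definition toC (R : realType) (x : R) : cplx R := Complex x 0.

Section SkewProducts.
Variable R : realType.
Local Notation C := (cplx R).

Definition disk (r : R) : set C := [set l | `|l| < toC r].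

Definition boundary (T : topologicalType) (A : set T) : set T :=
  closure A `\` A°.

Definition bounded_orbit (V : normedModType C) (g : V -> V) (x : V) :=
  exists M : R, forall n, `|iter n g x| <= toC M.

Definition poly_iter (p : {poly C}) (n : nat) : {poly C} :=
  iter n (fun s => p \Po s) 'X.

Definition filled_julia (p : {poly C}) : set C :=
  [set z | bounded_orbit (horner p) z].

Definition julia (p : {poly C}) : set C := boundary (filled_julia p).

Definition attracting_periodic (p : {poly C}) : set C :=
  [set a | exists2 n, (0 < n)%N &
     (poly_iter p n).[a] = a /\ `|(poly_iter p n)^`().[a]| < 1].

Definition hyperbolic (p : {poly C}) :=
  exists c L : R, [/\ 0 < c, 1 < L &
    forall z n, julia p z -> (1 <= n)%N ->
      toC (c * L ^+ n) <= `|(poly_iter p n)^`().[z]| ].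

(* [fiber] is a polynomial in w with coefficients in C[z]: the coefficient of
   z^i w^j is [(fiber f)`_j`_i]. *)
Record poly_skew := PolySkew { base : {poly C}; fiber : {poly {poly C}} }.

Definition fiber_poly (f : poly_skew) (z : C) : {poly C} :=
  map_poly (horner_eval z) (fiber f).

Definition skew_map (f : poly_skew) (x : C * C) : C * C :=
  ((base f).[x.1], (fiber_poly f x.1).[x.2]).

Definition homog1 (d : nat) (p : {poly C}) (x t : C) : C :=
  \sum_(i < d.+1) p`_i * x ^+ i * t ^+ (d - i).

Definition homog2 (d : nat) (q : {poly {poly C}}) (x y t : C) : C :=
  \sum_(i < d.+1) \sum_(j < d.+1 | (i + j <= d)%N)
    q`_j`_i * x ^+ i * y ^+ j * t ^+ (d - (i + j)).

(* f extends to a holomorphic endomorphism of P^2 of degree d: p and q have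
   degree at most d, and the homogeneous map of degree d
     [x : y : t] |-> [t^d p(x/t) : t^d q(x/t, y/t) : t^d]
   has no point of indeterminacy. *)
Definition extends_to_P2 (d : nat) (f : poly_skew) :=
  [/\ forall i, (d < i)%N -> (base f)`_i = 0,
      forall i j, (d < i + j)%N -> (fiber f)`_j`_i = 0 &
      forall x y t : C,
        homog1 d (base f) x t = 0 -> homog2 d (fiber f) x y t = 0 ->
        t ^+ d = 0 -> [/\ x = 0, y = 0 & t = 0] ].

Definition is_poly_skew_product (f : poly_skew) :=
  exists2 d, (2 <= d)%N & extends_to_P2 d f.

(* Q_z^n = q_{p^{n-1}(z)} o ... o q_{p(z)} o q_z *)
Fixpoint fiber_iter (f : poly_skew) (n : nat) (z : C) : {poly C} :=
  if n is m.+1 then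
    fiber_poly f (iter m (horner (base f)) z) \Po fiber_iter f m z
  else 'X.

(* The norm of C * C is the sup norm. *)
Definition filled_julia2 (f : poly_skew) : set (C * C) :=
  [set x | bounded_orbit (skew_map f) x].

(* K_z and J_z, regarded as subsets of C under w |-> (z, w) *)
Definition fiber_filled_julia (f : poly_skew) (z : C) : set C :=
  [set w | filled_julia2 f (z, w)].

Definition fiber_julia (f : poly_skew) (z : C) : set C :=
  boundary (fiber_filled_julia f z).

Definition vertical_line (z : C) : set (C * C) := [set z] `*` setT.

Definition julia2 (f : poly_skew) : set (C * C) :=
  closure (\bigcup_(z in julia (base f)) ([set z] `*` fiber_julia f z)).

(* Only used for the forward invariant compact sets J_p and A_p. *)
Definition vertically_expanding (f : poly_skew) (Z : set C) :=
  exists c L : R, [/\ 0 < c, 1 < L &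
    forall z w n, Z z -> fiber_julia f z w -> (1 <= n)%N ->
      toC (c * L ^+ n) <= `|(fiber_iter f n z)^`().[w]| ].

Definition axiomA (f : poly_skew) :=
  [/\ hyperbolic (base f),
      vertically_expanding f (julia (base f)) &
      vertically_expanding f (attracting_periodic (base f))].

(* [D] is meant to be open; the difference quotients defining [derivable] are
   taken along complex increments, the scalar field being [cplx R]. *)
Definition holomorphic_on (V : normedModType C) (D : set C) (g : C -> V) :=
  forall l, D l -> derivable g l 1.

(* Only the values at parameters in the unit disk matter. *)
Definition holomorphic_family (f : C -> poly_skew) :=
  [/\ forall l, disk 1 l -> is_poly_skew_product (f l),
      forall i, holomorphic_on (disk 1) (fun l => (base (f l))`_i : C) &
      forall i j, holomorphic_on (disk 1) (fun l => (fiber (f l))`_j`_i : C)].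

Definition holomorphic_motion (V : normedModType C) (r : R) (E : set V)
    (Phi : C -> V -> V) :=
  [/\ {within disk r `*` E, continuous (fun u : C * V => Phi u.1 u.2)},
      forall e, E e -> Phi 0 e = e,
      forall e, E e -> holomorphic_on (disk r) (Phi^~ e) &
      forall l, disk r l -> set_inj E (Phi l)].

(* The motion in Jonsson's theorem. Since Phi_l is a bijection from J_2(f_0)
   onto J_2(f_l), the relation f_l = Phi_l o f_0 o Phi_l^-1 on J_2(f_l) is
   written on J_2(f_0) as f_l o Phi_l = Phi_l o f_0. *)
Definition julia2_motion (r : R) (f : C -> poly_skew)
    (Phi : C -> C * C -> C * C) :=
  holomorphic_motion r (julia2 (f 0)) Phi /\
  forall l, disk r l ->
    Phi l @` julia2 (f 0) = julia2 (f l) /\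
    forall x, julia2 (f 0) x ->
      skew_map (f l) (Phi l x) = Phi l (skew_map (f 0) x).

(* Each Phi_l maps the slices of J_2(f_0) by vertical lines onto the slices of
   J_2(f_l); J_2(f) has nonempty slices only over J_p. *)
Definition preserves_vertical_fibration (r : R) (f : C -> poly_skew)
    (Phi : C -> C * C -> C * C) :=
  forall l z, disk r l -> julia (base (f 0)) z ->
    exists2 z', julia (base (f l)) z' &
      Phi l @` (julia2 (f 0) `&` vertical_line z) =
      julia2 (f l) `&` vertical_line z'.

End SkewProducts.

(* Main.v *)
Require Import Defs.
From mathcomp Require Import all_boot all_order all_algebra.
From mathcomp Require Import complex cyclic ring lra.
From mathcomp Require Import all_classical all_reals all_analysis.

Set Implicit Arguments.
Unset Strict Implicit.
Unset Printing Implicit Defensive.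

Import Order.TTheory GRing.Theory Num.Theory.
Import numFieldNormedType.Exports.

Local Open Scope classical_set_scope.
Local Open Scope ring_scope.

(** For z in J_p, vertical expansion extends by continuity to the part of J_2 over
    z, while Cauchy's estimate bounds the derivatives of all iterates at an
    interior point of K_z; hence J_2 meets the vertical line over z exactly in J_z.

    Let x1, x2 be points of J_2(f_0) whose images under Phi_l0 have the same first
    coordinate. The motion conjugates f_0 to f_l, so the first coordinates of the
    orbits of Phi_l(x1) and Phi_l(x2) are p_l-orbits that coincide at l = l0. By
    compactness of J_2(f_0) they stay close for l near l0, uniformly in time, and
    as an iterate of p_l0 is strongly expanding on J_p this forces them to agree
    for l near l0. So the parameters at which the first coordinates agree form a
    clopen subset of the disk: Phi_l neither separates nor merges vertical fibers.

    The uniformity in l needs a bound on deg p_l. It comes from counting preimages: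
    every point of J_2(f_l) has at least deg p_l preimages in J_2(f_l), since
    critical points of p_l avoid J_p, and the motion preserves this number. *)

(** * Norms and polynomials *)

Section ComplexNorm.
Variable R : realType.
Local Notation C := (cplx R).
Implicit Types (x y : R) (z w : C).

Lemma toC_le x y : (toC x <= toC y) = (x <= y).
Proof. exact: lecR. Qed.

Lemma toC_lt x y : (toC x < toC y) = (x < y).
Proof. exact: ltcR. Qed.

Lemma toC0 : toC (0 : R) = 0.
Proof. by []. Qed.

Lemma toC1 : toC (1 : R) = 1.
Proof. by []. Qed.

Lemma toCM x y : toC (x * y) = toC x * toC y.
Proof. exact: (rmorphM (@real_complex R)). Qed.

Lemma toCD x y : toC (x + y) = toC x + toC y.
Proof. exact: (rmorphD (@real_complex R)). Qed.

Lemma toCB x y : toC (x - y) = toC x - toC y.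
Proof. exact: (rmorphB (@real_complex R)). Qed.

Lemma toCV x : toC x^-1 = (toC x)^-1.
Proof. exact: (fmorphV (@real_complex R)). Qed.

Lemma toCX x n : toC (x ^+ n) = toC x ^+ n.
Proof. exact: (rmorphXn (@real_complex R)). Qed.

Lemma toC_nat n : toC (n%:R : R) = n%:R.
Proof. exact: (rmorph_nat (@real_complex R)). Qed.

Lemma toC_Re z : z \is Num.real -> z = toC (complex.Re z).
Proof.
case: z => a b; rewrite realE => /orP[].
- by move=> h; have := h; rewrite lecE /= => /andP[/eqP -> _].
- by move=> h; have := h; rewrite lecE /= => /andP[/eqP <- _].
Qed.

Lemma toC_gt0 z : 0 < z -> exists2 x, 0 < x & z = toC x.
Proof.
move=> z0; have zE := toC_Re (gtr0_real z0); exists (complex.Re z) => //.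
by move: z0; rewrite {1}zE -toC0 toC_lt.
Qed.

Lemma norm_toC z : exists2 x, 0 <= x & `|z| = toC x.
Proof.
exists (complex.Re `|z|); last exact/toC_Re/normr_real.
by rewrite -toC_le -toC_Re ?normr_real// toC0.
Qed.

Lemma norm_leNgt z w : (`|z| <= `|w|) = ~~ (`|w| < `|z|).
Proof. by rewrite real_leNgt ?normr_real. Qed.

Lemma norm_le_toC z x : (`|z| <= toC x) = ~~ (toC x < `|z|).
Proof. by have [y _ ->] := norm_toC z; rewrite toC_le toC_lt leNgt. Qed.

Lemma exp2_unbounded x y : (forall n, 2 ^+ n * x <= y) -> x <= 0.
Proof.
move=> h; rewrite leNgt; apply/negP => x0.
have hn n : n%:R <= (2 : R) ^+ n.
  elim: n => [|n IH]; first by rewrite expr0.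
  rewrite exprS -natr1; have : (1 : R) <= 2 ^+ n by rewrite exprn_ege1// ler1n.
  lra.
have := h (Num.bound `|y / x|); apply/negP; rewrite -ltNge -ltr_pdivrMr//.
apply: le_lt_trans (ler_norm _) _; apply: lt_le_trans (archi_boundP _) (hn _).
exact: normr_ge0.
Qed.

Lemma expr_gt (L a : R) : 1 < L -> exists n, a < L ^+ n.
Proof.
move=> L1; have hn n : 1 + n%:R * (L - 1) <= L ^+ n.
  elim: n => [|n IH]; first by rewrite expr0 mul0r addr0.
  rewrite exprS -natr1; have := @ler_pM R (1 + (L - 1)) L (1 + n%:R * (L - 1)) (L ^+ n).
  have L0 : 0 <= L - 1 by lra.
  have n0 : 0 <= n%:R * (L - 1) by rewrite mulr_ge0.
  have n1 : 0 <= n%:R * (L - 1) * (L - 1) by rewrite mulr_ge0.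
  move=> /(_ _ _ _ IH) h; have {}h := h ltac:(lra) ltac:(lra) ltac:(lra).
  by apply: le_trans h; lra.
have [n hn'] : exists n : nat, a / (L - 1) < n%:R.
  exists (Num.bound `|a / (L - 1)|).
  by apply: le_lt_trans (ler_norm _) (archi_boundP _); exact: normr_ge0.
exists n; apply: lt_le_trans (hn n).
by move: hn'; rewrite ltr_pdivrMr ?subr_gt0//; lra.
Qed.

(** From [n0] on the sequence dominates [2 ^+ n * |u n0|], which is bounded only if [u n0] vanishes.
    This is how expansion forces two orbits to coincide. *)
Lemma doubling_bounded (u : nat -> C) x n0 : (forall n, `|u n| <= toC x) ->
  (forall n, (n0 <= n)%N -> 2 * `|u n| <= `|u n.+1|) -> u n0 = 0.
Proof.
move=> hx h.
have hn n : 2 ^+ n * `|u n0| <= `|u (n0 + n)%N|.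
  elim: n => [|n IH]; first by rewrite expr0 mul1r addn0.
  rewrite exprS -mulrA addnS; apply: le_trans (h _ (leq_addr _ _)).
  by rewrite ler_pM2l.
apply/normr0_eq0; have [y y0 yE] := norm_toC (u n0); rewrite yE.
suff : y <= 0 by move=> y0'; congr toC; apply/le_anti/andP.
apply: (@exp2_unbounded y x) => n.
rewrite -toC_le toCM toCX toC_nat -yE.
exact: le_trans (hn n) (hx _).
Qed.

(** A term above [y] would keep all later terms above [y] and doubling. Applied to orbits, it
    replaces an orbit-dependent bound by the escape radius. *)
Lemma doubling_trapped (u : nat -> C) x y : 0 <= y -> (forall n, `|u n| <= toC x) ->
  (forall n, toC y < `|u n| -> 2 * `|u n| <= `|u n.+1|) ->
  forall n, `|u n| <= toC y.
Proof.
move=> y0 hx h n0; rewrite norm_le_toC; apply/negP => un0.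
have hn n : (n0 <= n)%N -> toC y < `|u n|.
  elim: n => [|n IH]; first by rewrite leqn0 => /eqP <-.
  rewrite leq_eqVlt => /predU1P[<-//|]; rewrite ltnS => /IH yn.
  apply: lt_le_trans yn (le_trans _ (h _ yn)).
  by rewrite ler_peMl// ler1n.
have := doubling_bounded hx (fun n n0n => h _ (hn n n0n)).
by move=> u0; move: un0; rewrite u0 normr0 -toC0 toC_lt ltNge y0.
Qed.

End ComplexNorm.

Section ClosedFieldPoly.
Variable F : closedFieldType.
Implicit Types (p : {poly F}) (x y : F).

(** A linear factor occurring twice would make its root a root of the derivative as well. *)
Lemma simple_roots_seq p : p != 0 ->
  (forall x, root p x -> ~~ root p^`() x) ->
  exists s : seq F, [/\ uniq s, size s = (size p).-1 & forall x, (x \in s) = root p x].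
Proof.
move=> p0 simple; have [s pE] := closed_field_poly_normal p.
have lc0 : lead_coef p != 0 by rewrite lead_coef_eq0.
have sE x : (x \in s) = root p x by rewrite pE rootZ// root_prod_XsubC.
exists s; split => //; last first.
  by rewrite pE size_scale// size_prod_XsubC.
apply: count_mem_uniq => x.
case: (boolP (x \in s)) => [xs|/count_memPn//].
have := simple x; rewrite -sE => /(_ xs).
have sx := perm_to_rem xs; rewrite (permP sx) /= eqxx.
rewrite pE (perm_big _ sx) big_cons /= derivZ derivM derivXsubC mul1r rootZ//.
rewrite rootE !hornerE subrr mul0r addr0 => h.
suff /count_memPn -> : x \notin rem x s by [].
by rewrite -root_prod_XsubC rootE.
Qed.

Lemma horner_root_surj p y : (1 < size p)%N -> exists x, p.[x] = y.
Proof.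
move=> sp; have /closed_rootP[x] : size (p - y%:P) != 1%N.
  rewrite size_polyDl ?size_polyN; first by rewrite neq_ltn sp orbT.
  exact: leq_ltn_trans (size_polyC_leq1 _) sp.
by rewrite rootE hornerD hornerN hornerC subr_eq0 => /eqP; exists x.
Qed.

Lemma horner_preimage_seq p y : (1 < size p)%N ->
  exists s : seq F, forall x, p.[x] = y -> x \in s.
Proof.
move=> sp; have [s pE] := closed_field_poly_normal (p - y%:P).
exists s => x xy; have : root (p - y%:P) x.
  by rewrite rootE hornerD hornerN hornerC xy subrr.
rewrite pE rootZ ?root_prod_XsubC// lead_coef_eq0 subr_eq0.
by apply: contraTneq sp => ->; rewrite -leqNgt size_polyC_leq1.
Qed.

End ClosedFieldPoly.

Section PolyEstimates.
Variable K : numClosedFieldType.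
Implicit Types (p : {poly K}) (x y z w : K).

(** In characteristic 0 the roots of ['X^n - 1] are simple, and [n] distinct n-th roots of unity in
    a field include a primitive one. *)
Lemma prim_root_exists n : (0 < n)%N -> exists z : K, n.-primitive_root z.
Proof.
move=> n0; have sX : size ('X^n - 1 : {poly K}) = n.+1 by rewrite size_XnsubC.
have X0 : 'X^n - 1 != 0 :> {poly K} by rewrite -size_poly_eq0 sX.
have [|s [us ss sE]] := @simple_roots_seq K ('X^n - 1) X0.
  move=> x; rewrite rootE !hornerE subr_eq0 => /eqP xn.
  rewrite derivB derivXn derivC subr0 rootE hornerMn ?hornerXn ?hornerE mulrn_eq0.
  rewrite negb_or -lt0n n0 /=; apply: contra_eq_neq xn => xn.
  by rewrite -(prednK n0) exprS xn mulr0 eq_sym oner_eq0.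
have /hasP[z _ hz] : has n.-primitive_root s.
  apply: has_prim_root => //; last by rewrite ss sX.
  by apply/allP => x; rewrite sE /root_of_unity.
by exists z.
Qed.

Lemma sum_prim_root_expr n (z : K) m : n.-primitive_root z ->
  \sum_(k < n) (z ^+ m) ^+ k = (if (n %| m)%N then n%:R else 0).
Proof.
move=> pz; case: ifPn => nm.
  rewrite (eq_bigr (fun=> 1)) ?sumr_const ?card_ord// => k _.
  by move: nm; rewrite (prim_order_dvd pz) => /eqP ->; rewrite expr1n.
have := subrX1 (z ^+ m) n; rewrite exprAC (prim_expr_order pz) expr1n subrr.
move/esym/eqP; rewrite mulf_eq0 subr_eq0 -(prim_order_dvd pz) (negPf nm).
by move/eqP.
Qed.

(* Cauchy's estimate: averaging p(w + rho zeta^k) / zeta^k over the n-th roots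
   of unity, n > deg p, isolates the linear Taylor coefficient. *)
Lemma deriv_bound p w (rho M : K) : 0 < rho ->
  (forall u, `|u - w| <= rho -> `|p.[u]| <= M) -> `|p^`().[w]| <= M / rho.
Proof.
move=> rho0 pM; pose n := (size p).+2.
have [z pz] := @prim_root_exists n isT.
have z1 : `|z| = 1.
  apply/eqP; rewrite -(@pexpr_eq1 _ _ n)//.
  by rewrite -normrX (prim_expr_order pz) normr1.
pose q := p \Po (w%:P + rho *: 'X).
have sl : (size (w%:P + rho *: 'X : {poly K})%R <= 2)%N.
  rewrite (leq_trans (size_polyD _ _))// geq_max.
  rewrite (leq_trans (size_polyC_leq1 _))//=.
  by rewrite (leq_trans (size_scale_leq _ _))// size_polyX.
have sq : (size q <= n)%N.
  rewrite (leq_trans (size_comp_poly_leq _ _))// /n ltnS.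
  have l1 : ((size (w%:P + rho *: 'X : {poly K})%R).-1 <= 1)%N by case: size sl => [|[|[]]].
  by rewrite (leq_trans (leq_mul (leqnn _) l1))// muln1 (leq_trans (leq_pred _)).
have q1 : q`_1 = rho * p^`().[w].
  have := coef_deriv q 0; rewrite mulr1n => <-.
  rewrite -horner_coef0 /q deriv_comp hornerM horner_comp !hornerE.
  rewrite derivD derivC derivZ derivX add0r alg_polyC hornerC.
  by rewrite ?mulr0 ?addr0 mulrC.
(* The power [n.-1] plays the part of the inverse, since [z ^+ n = 1]. *)
have avg : n%:R * q`_1 = \sum_(k < n) (z ^+ k) ^+ n.-1 * p.[w + rho * z ^+ k].
  transitivity (\sum_(k < n) \sum_(i < n) (z ^+ (n.-1 + i)) ^+ k * q`_i).
    rewrite exchange_big /= (bigD1 (inord 1)) //= [X in _ + X]big1 => [|i i1].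
      rewrite -mulr_suml inordK// sum_prim_root_expr// addn1 dvdnn addr0//.
    rewrite -mulr_suml sum_prim_root_expr//; case: ifPn; rewrite ?mul0r// => ni.
    case/negP: i1; apply/eqP/val_inj; rewrite /= inordK//.
    case: i ni => -[|[|i]] /= li.
    - by rewrite addn0 gtnNdvd.
    - by [].
    - by rewrite addnS addnS -addSn -addnS dvdn_addr// gtnNdvd// -ltnS ltnW// ltnW.
  apply: eq_bigr => k _; have -> : p.[w + rho * z ^+ k] = q.[z ^+ k].
    by rewrite /q horner_comp !hornerE.
  rewrite (horner_coef_wide _ sq) mulr_sumr; apply: eq_bigr => i _.
  by rewrite mulrA mulrAC -exprD -!exprM mulnC.
have : `|n%:R * q`_1| <= n%:R * M.
  rewrite avg (le_trans (ler_norm_sum _ _ _))//.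
  rewrite mulr_natl -[X in _ *+ X]card_ord -sumr_const ler_sum// => k _.
  rewrite normrM !normrX z1 !expr1n mul1r pM// [w + _]addrC addrK normrM normrX.
  by rewrite z1 expr1n mulr1 gtr0_norm.
rewrite normrM q1 normrM normr_nat ler_pM2l ?ltr0n// (gtr0_norm rho0).
by rewrite ler_pdivlMr// mulrC.
Qed.

(* Some root of p - y lies this close to x because the distances from x to the
   roots multiply to |p(x) - y| / |lead_coef p|. *)
Lemma near_root p x y : (1 < size p)%N ->
  exists2 r, p.[r] = y & `|x - r| ^+ (size p).-1 <= `|p.[x] - y| / `|lead_coef p|.
Proof.
move=> sp; pose q := p - y%:P.
have sy : (size (- y%:P : {poly K})%R < size p)%N.
  by rewrite size_polyN (leq_ltn_trans (size_polyC_leq1 _)).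
have sq : size q = size p by rewrite /q size_polyDl.
have lq : lead_coef q = lead_coef p by rewrite /q lead_coefDl.
have [s qE] := closed_field_poly_normal q.
have lc0 : lead_coef q != 0 by rewrite lead_coef_eq0 -size_poly_eq0 sq -lt0n ltnW.
have ss : size s = (size p).-1.
  by rewrite -sq qE size_scale// size_prod_XsubC.
have qx : p.[x] - y = lead_coef p * \prod_(r <- s) (x - r).
  have -> : p.[x] - y = q.[x] by rewrite /q !hornerE.
  rewrite qE hornerZ lq; congr (_ * _); rewrite horner_prod.
  by apply: eq_bigr => r _; rewrite !hornerE.
rewrite qx normrM mulrC mulKf; last by rewrite normr_eq0 -lq.
have hs r : r \in s -> p.[r] = y.
  rewrite -root_prod_XsubC => rs; apply/eqP; rewrite -subr_eq0.
  have -> : p.[r] - y = q.[r] by rewrite /q !hornerE.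
  by rewrite qE hornerZ (rootP rs) mulr0.
have s0 : (0 < size s)%N by rewrite ss; case: (size p) sp => [|[]].
rewrite normr_prod -ss.
(* The smallest factor, raised to the number of factors, is at most the product; the induction keeps
   track of a nearest root. *)
elim: s s0 {qE ss qx} hs => // a s IH _ hs.
rewrite big_cons /=; case: s IH hs => [_ hs|b s IH hs].
  exists a; first by rewrite hs// inE.
  by rewrite big_nil /= expr1 mulr1.
have [||r rs hr] := IH => //; first by move=> r rs; rewrite hs// inE rs orbT.
have [ra|ar] := real_leP (normr_real (x - r)) (normr_real (x - a)).
  by exists r => //; rewrite exprS ler_pM// ?exprn_ge0.
exists a; first by rewrite hs ?inE ?eqxx.
rewrite exprS ler_pM// ?exprn_ge0//; apply: le_trans hr.
by rewrite lerXn2r ?nnegrE// ltW.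
Qed.

End PolyEstimates.

(** * Topology of the complex plane *)

Section Continuity.
Variables (K : numFieldType) (T : Type) (F : set_system T).
Context {FF : Filter F}.

Lemma cvg_sum_ord n (f : 'I_n -> T -> K) (l : 'I_n -> K) :
  (forall i, f i t @[t --> F] --> l i) ->
  \sum_i f i t @[t --> F] --> \sum_i l i.
Proof.
elim: n f l => [|n IH] f l h.
  by rewrite big_ord0; under eq_fun do rewrite big_ord0; exact: cvg_cst.
rewrite big_ord_recl; under eq_fun do rewrite big_ord_recl.
by apply: cvgD => //; apply: IH.
Qed.

Lemma cvg_prod_ord n (f : 'I_n -> T -> K) (l : 'I_n -> K) :
  (forall i, f i t @[t --> F] --> l i) ->
  \prod_i f i t @[t --> F] --> \prod_i l i.
Proof.
elim: n f l => [|n IH] f l h.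
  by rewrite big_ord0; under eq_fun do rewrite big_ord0; exact: cvg_cst.
rewrite big_ord_recl; under eq_fun do rewrite big_ord_recl.
by apply: cvgM => //; apply: IH.
Qed.

Lemma cvg_powr n (f : T -> K) (l : K) :
  f t @[t --> F] --> l -> f t ^+ n @[t --> F] --> l ^+ n.
Proof.
move=> h; elim: n => [|n IH].
  by rewrite expr0; under eq_fun do rewrite expr0; exact: cvg_cst.
by rewrite exprS; under eq_fun do rewrite exprS; exact: cvgM.
Qed.

Lemma cvg_horner (p : {poly K}) (f : T -> K) (l : K) :
  f t @[t --> F] --> l -> p.[f t] @[t --> F] --> p.[l].
Proof.
move=> h; rewrite horner_coef; under eq_fun do rewrite horner_coef.
apply: (@cvg_sum_ord _ (fun i t => p`_i * f t ^+ i) (fun i => p`_i * l ^+ i)) => i.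
by apply: cvgM; [exact: cvg_cst|exact: (cvg_powr h)].
Qed.

End Continuity.

Lemma horner_continuous (K : numFieldType) (p : {poly K}) : continuous (horner p).
Proof. by move=> x; apply: (@cvg_horner K K (nbhs x) _ p id x). Qed.

Section ComplexTopology.
Variable R : realType.
Local Notation C := (cplx R).
Implicit Types (x y : R) (z w : C) (p : {poly C}).

Lemma nbhs_normC z (A : set C) :
  nbhs z A <-> exists2 e : R, 0 < e & forall u : C, `|u - z| < toC e -> A u.
Proof.
split=> [/nbhs_ballP[e /= e0 eA]|[e e0 eA]].
  have [x x0 xE] := toC_gt0 e0; exists x => // u uz; apply: eA.
  by rewrite -ball_normE /ball_/= distrC xE.
apply/nbhs_ballP; exists (toC e); first by rewrite /= -toC0 toC_lt.
by move=> u; rewrite -ball_normE /ball_/= distrC => /eA.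
Qed.

Lemma norm_toCE x : `|toC x| = toC `|x|.
Proof.
wlog x0 : x / 0 <= x => [hw|].
  have [/hw//|x0] := leP 0 x.
  have -> : toC x = - toC (- x) by rewrite -[- x]sub0r toCB sub0r opprK.
  by rewrite normrN hw ?normrN// oppr_ge0 ltW.
by rewrite (ger0_norm x0) ger0_norm -?[0]toC0 ?toC_le.
Qed.

Lemma continuous_toC : continuous (@toC R : R -> C).
Proof.
move=> x A /(nbhs_normC (toC x) A)[e e0 eA]; apply/nbhs_ballP; exists e => //= y.
rewrite -ball_normE /ball_/= => xy; apply: eA.
by rewrite -toCB norm_toCE toC_lt distrC.
Qed.

Lemma complex_rect z : z = toC (complex.Re z) + Complex 0 1 * toC (complex.Im z).
Proof.
case: z => a b; apply/eqP; rewrite eq_complex /=.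
by rewrite !(mul0r, mulr0, mul1r, addr0, add0r, subr0, eqxx).
Qed.

Lemma norm_ReIm_le z :
  `|complex.Re z| <= complex.Re `|z| /\ `|complex.Im z| <= complex.Re `|z|.
Proof.
case: z => a b /=; split.
  by rewrite -sqrtr_sqr ler_wsqrtr// lerDl sqr_ge0.
by rewrite -sqrtr_sqr ler_wsqrtr// lerDr sqr_ge0.
Qed.

Lemma closed_disk_closed (M : R) : closed [set z : C | `|z| <= toC M].
Proof.
move=> z clz /=; rewrite norm_le_toC; apply/negP => zM.
have [x x0 zx] := norm_toC z; move: zM; rewrite zx toC_lt => Mx.
have [|u [/= uM uz]] := clz [set u | `|u - z| < toC (x - M)].
  by apply/nbhs_normC; exists (x - M); rewrite ?subr_gt0.
have : `|z| <= `|u| + `|u - z| by rewrite -{1}[z](subKr u) ler_normB.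
rewrite zx => /(le_lt_trans)/(_ (ler_ltD uM uz)).
by rewrite -toCD addrC subrK toC_lt ltxx.
Qed.

(** Compactness is transported from the real square of side [2 * M]: the disk is a closed subset of
    its continuous image. *)
Lemma closed_disk_compact (M : R) : compact [set z : C | `|z| <= toC M].
Proof.
pose g (t : R * R) : C := toC t.1 + Complex 0 1 * toC t.2.
have cg : continuous g.
  move=> t; apply: cvgD.
    by apply: continuous_cvg; [exact: continuous_toC|exact: cvg_fst].
  apply: cvgM; first exact: cvg_cst.
  by apply: continuous_cvg; [exact: continuous_toC|exact: cvg_snd].
apply: (@subclosed_compact _ _ (g @` (`[- M, M] `*` `[- M, M]))).
- exact: closed_disk_closed.
- apply: continuous_compact; first exact: continuous_subspaceT.
  by apply: compact_setX; exact: segment_compact.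
- move=> z /= zM; exists (complex.Re z, complex.Im z); last first.
    by rewrite /g /= -complex_rect.
  have [x x0 zx] := norm_toC z.
  move: zM; rewrite zx toC_le => xM; have [] := norm_ReIm_le z.
  by rewrite zx /= !in_itv /= -!ler_norml => h1 h2; split; exact: le_trans xM.
Qed.

Lemma compact_prod_bounded (A : set (C * C)) (M : R) : closed A ->
  (forall u, A u -> `|u| <= toC M) -> compact A.
Proof.
move=> cA AM; apply: (subclosed_compact cA
  (compact_setX (@closed_disk_compact M) (@closed_disk_compact M))).
move=> [z w] /AM; rewrite prod_normE /= /Num.max.
case: ifPn => zw h; split => //=.
  exact: le_trans (ltW zw) h.
by move: zw; rewrite -norm_leNgt => /le_trans; exact.
Qed.

(** Openness of nonconstant polynomials, without complex analysis: by [near_root], a value within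
    [|lead_coef p| * e ^+ deg p] of [p.[z]] is taken within [e] of [z]. *)
Lemma horner_open p z (A : set C) : (1 < size p)%N ->
  nbhs z A -> nbhs p.[z] (horner p @` A).
Proof.
move=> sp /nbhs_normC[e e0 eA]; apply/nbhs_normC.
have lc0 : 0 < `|lead_coef p|.
  by rewrite normr_gt0 lead_coef_eq0 -size_poly_eq0; case: (size p) sp.
have [c c0 cE] := toC_gt0 lc0.
have sp0 : (0 < (size p).-1)%N by case: (size p) sp => [|[]].
exists (c * e ^+ (size p).-1); first by rewrite mulr_gt0// exprn_gt0.
move=> u up; have [r ru hr] := near_root z u sp; exists r => //.
apply: eA; rewrite distrC -(@ltr_pXn2r _ (size p).-1) ?nnegrE//; last first.
  by rewrite -toC0 toC_le ltW.
apply: (le_lt_trans hr); rewrite cE ltr_pdivrMr; last by rewrite -toC0 toC_lt.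
by rewrite distrC mulrC -toCX -toCM.
Qed.

(** Connectedness of the unit interval. The local condition is asked only along the segment, so the
    lemma applies inside any convex set. *)
Lemma segment_clopen (P : set C) (a b : C) :
  (forall t : R, 0 <= t <= 1 ->
     nbhs (a + toC t * (b - a)) P \/ nbhs (a + toC t * (b - a)) (~` P)) ->
  P a -> P b.
Proof.
move=> nP Pa; pose g t : C := a + toC t * (b - a).
have cg : continuous g.
  move=> t; apply: cvgD; first exact: cvg_cst.
  by apply: cvgM; [exact: continuous_toC|exact: cvg_cst].
have g0 : g 0 = a by rewrite /g toC0 mul0r addr0.
have g1 : g 1 = b by rewrite /g toC1 mul1r addrC subrK.
have BE := @segment_connected R 0 1 (`[0, 1] `&` g @^-1` P).
suff : (`[0, 1] `&` g @^-1` P) (1 : R) by rewrite -g1 => -[].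
rewrite BE /= ?in_itv /= ?ler01 ?lexx//.
- by exists 0; split; rewrite /= ?in_itv /= ?lexx ?ler01 // g0.
- exists (g @^-1` P°).
    by apply: open_comp; [move=> t _; exact: cg|exact: open_interior].
  rewrite eqEsubset; split=> t /= [t01 Pt]; split => //.
    by have [|//|/nbhs_singleton] := nP t; first by move: t01; rewrite in_itv.
  exact: interior_subset Pt.
- exists (~` (g @^-1` (~` P)°)).
    apply: open_closedC.
    by apply: open_comp; [move=> t _; exact: cg|exact: open_interior].
  rewrite eqEsubset; split=> t /= [t01 Pt]; split => //.
    by move/interior_subset.
  by have [|/nbhs_singleton|] := nP t; first by move: t01; rewrite in_itv.
Qed.

End ComplexTopology.

(** * Escape radii and Julia sets *)

Section SkewProduct.
Variable R : realType.
Local Notation C := (cplx R).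
Implicit Types (z w : C) (p : {poly C}) (f : poly_skew R).

Lemma homog1_at_infinity d p (x : C) : (0 < d)%N ->
  homog1 d p x 0 = p`_d * x ^+ d.
Proof.
move=> d0; rewrite /homog1 big_ord_recr /= subnn expr0 mulr1 big1 ?add0r// => i _.
by rewrite expr0n subn_eq0 leqNgt ltn_ord mulr0.
Qed.

Lemma homog2_at_infinity d (q : {poly {poly C}}) (x y : C) :
  homog2 d q x y 0 = \sum_(j < d.+1) q`_j`_(d - j) * x ^+ (d - j) * y ^+ j.
Proof.
rewrite /homog2 (exchange_big_dep xpredT)//=; apply: eq_bigr => j _.
have jd : (j <= d)%N by rewrite -ltnS.
have ij : (@inord d (d - j) : nat) = (d - j)%N by rewrite inordK// ltnS leq_subr.
rewrite (bigD1 (inord (d - j))) /=; last by rewrite ij subnK.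
rewrite ij subnK// subnn expr0 mulr1 big1 ?addr0// => i /andP[ijd ni].
rewrite [0 ^+ _]expr0n subn_eq0 leqNgt ltn_neqAle ijd andbT.
case: eqP => /= [e|]; last by rewrite mulr0.
by case/negP: ni; apply/eqP/val_inj; rewrite /= ij; exact: (canRL (addnK j) e).
Qed.

(** If the coefficient of [w^d] vanished, [[0 : 1 : 0]] would be a point of indeterminacy. If that
    of [z^d] in the base vanished, so would be [[1 : y : 0]], where [y] is a root of the top-degree
    part of the fiber map at [x = 1]; this root exists because the coefficient of [w^d] is
    nonzero. *)
Lemma extends_leading d f : (2 <= d)%N -> extends_to_P2 d f ->
  (base f)`_d != 0 /\ (fiber f)`_d`_0 != 0.
Proof.
move=> d2 [_ _ H]; have d0 : (0 < d)%N by exact: ltnW.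
have b0 : (fiber f)`_d`_0 != 0.
  apply/eqP => b0; have [|||_ /eqP] := H 0 1 0.
  - by rewrite homog1_at_infinity// expr0n gtn_eqF// mulr0.
  - rewrite homog2_at_infinity big_ord_recr /= subnn b0 !mul0r addr0 big1// => j _.
    by rewrite expr0n subn_eq0 leqNgt ltn_ord mulr0 mul0r.
  - by rewrite expr0n gtn_eqF.
  - by rewrite oner_eq0.
split=> //; apply/eqP => a0.
pose s := \poly_(j < d.+1) (fiber f)`_j`_(d - j).
have /closed_rootP[y /rootP sy] : size s != 1%N.
  by rewrite size_poly_eq /= ?subnn// gtn_eqF.
have [|||/eqP] := H 1 y 0.
- by rewrite homog1_at_infinity// a0 mul0r.
- rewrite homog2_at_infinity -[RHS]sy horner_poly; apply: eq_bigr => j _.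
  by rewrite expr1n mulr1.
- by rewrite expr0n gtn_eqF.
- by rewrite oner_eq0.
Qed.

Lemma extends_size_base d f : (2 <= d)%N -> extends_to_P2 d f ->
  size (base f) = d.+1.
Proof.
move=> d2 H; have [a0 _] := extends_leading d2 H; have [h _ _] := H.
apply/eqP; rewrite eqn_leq; apply/andP; split; first exact/leq_sizeP.
by rewrite ltnNge; apply: contra a0 => /leq_sizeP ->.
Qed.

Lemma fiber_polyE f z j : (fiber_poly f z)`_j = ((fiber f)`_j).[z].
Proof. by rewrite coef_map. Qed.

(** Total degree at most [d] makes the coefficient of [w^d] constant in [z], so all fiber
    polynomials share their degree and leading coefficient. *)
Lemma extends_fiber_poly d f z : (2 <= d)%N -> extends_to_P2 d f ->
  size (fiber_poly f z) = d.+1 /\ (fiber_poly f z)`_d = (fiber f)`_d`_0.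
Proof.
move=> d2 H; have [_ b0] := extends_leading d2 H; have [_ h _] := H.
have bE : (fiber_poly f z)`_d = (fiber f)`_d`_0.
  rewrite fiber_polyE [X in X.[z]](_ : _ = ((fiber f)`_d`_0)%:P) ?hornerC//.
  by apply: size1_polyC; apply/leq_sizeP => i i0; rewrite h// -[X in (X < _)%N]add0n ltn_add2r.
split=> //; apply/eqP; rewrite eqn_leq; apply/andP; split.
  apply/leq_sizeP => j dj; rewrite fiber_polyE (_ : (fiber f)`_j = 0) ?horner0//.
  by apply/polyP => i; rewrite coef0 h// (leq_trans dj)// leq_addl.
by rewrite ltnNge; apply/negP => /leq_sizeP/(_ _ (leqnn d)); rewrite bE => /eqP; apply/negP.
Qed.

(** The radius depends on [q] only through its top coefficient and a bound on the others, hence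
    serves all fibers over a bounded set at once. *)
Lemma escape_radius d (b : C) (c : R) : (2 <= d)%N -> b != 0 -> 0 <= c ->
  exists2 M : R, 0 < M & forall q : {poly C}, (size q <= d.+1)%N -> q`_d = b ->
    (forall j, (j < d)%N -> `|q`_j| <= toC c) ->
    forall w, toC M < `|w| -> 2 * `|w| <= `|q.[w]|.
Proof.
move=> d2; rewrite -normr_gt0 => /toC_gt0[be be0 bE] c0.
have dc0 : 0 <= d%:R * c by rewrite mulr_ge0.
(* The summand 1 gives [|w| >= 1], so the lower terms add up to at most [d * c * |w| ^+ d.-1]; the
   other summand gives [be * |w| - d * c >= 2]. *)
exists (1 + (2 + d%:R * c) / be) => [|q sq qd qj w Mw].
  by rewrite addr_gt0// divr_gt0// ltr_wpDr.
have [x _ xE] := norm_toC w; move: Mw; rewrite xE toC_lt => Mx.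
have x1 : 1 <= x.
  by apply: le_trans (ltW Mx); rewrite lerDl divr_ge0 ?(ltW be0)// addr_ge0.
have x0 : 0 < x by exact: lt_le_trans x1.
have bx : 2 <= be * x - d%:R * c.
  have : be * (1 + (2 + d%:R * c) / be) <= be * x by rewrite ler_pM2l// ltW.
  by rewrite mulrDr mulrCA divff ?gt_eqF// !mulr1; lra.
rewrite (horner_coef_wide _ sq) big_ord_recr /= qd.
set s := \sum_(i < d) _.
have sle : `|s| <= toC (d%:R * c * x ^+ d.-1).
  rewrite (le_trans (ler_norm_sum _ _ _))// -mulrA toCM toC_nat mulr_natl.
  rewrite -[X in _ *+ X]card_ord -sumr_const ler_sum// => i _.
  rewrite normrM normrX xE -toCX toCM ler_pM ?qj//.
    by rewrite -toC0 toC_le exprn_ge0// ltW.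
  by rewrite toC_le ler_weXn2l// -ltnS prednK//; exact: ltnW.
have : `|b * w ^+ d| <= `|s + b * w ^+ d| + `|s|.
  by rewrite -{1}[b * _](addKr s) addrC ler_normB.
rewrite normrM normrX xE bE -toCX -toCM -lerBlDr => h.
apply: le_trans h; rewrite -[2]/(2%:R) -toC_nat -toCM.
apply: le_trans (lerB (lexx _) sle); rewrite -toCB toC_le.
have -> : be * x ^+ d - d%:R * c * x ^+ d.-1 = (be * x - d%:R * c) * x ^+ d.-1.
  by rewrite -{1}(prednK (ltnW d2)) exprS; ring.
by rewrite ler_pM ?(ltW x0)// -{1}[x]expr1 ler_weXn2l// -ltnS prednK// ltnW.
Qed.

Lemma poly_bounded p (M : R) : exists2 B : R, 0 <= B &
  forall z, `|z| <= toC M -> `|p.[z]| <= toC B.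
Proof.
have : 0 <= \sum_(i < size p) `|p`_i| * `|toC M| ^+ i.
  by apply: sumr_ge0 => i _; rewrite mulr_ge0// exprn_ge0.
rewrite le_eqVlt => B0.
have [B B0' BE] : exists2 B : R, 0 <= B & \sum_(i < size p) `|p`_i| * `|toC M| ^+ i = toC B.
  case/predU1P: B0 => [<-|/toC_gt0[B B0 ->]]; first by exists 0.
  by exists B => //; exact: ltW.
exists B => // z zM; rewrite -BE horner_coef (le_trans (ler_norm_sum _ _ _))//.
apply: ler_sum => i _; rewrite normrM normrX ler_wpM2l// lerXn2r// ?nnegrE//.
by rewrite (le_trans zM)// real_ler_norm// realE -toC0 !toC_le le_total.
Qed.

Lemma escape_radii f : is_poly_skew_product f -> exists M1 M2 : R,
  [/\ 0 <= M1, 0 <= M2,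
      forall z, toC M1 < `|z| -> 2 * `|z| <= `|(base f).[z]| &
      forall z w, `|z| <= toC M1 -> toC M2 < `|w| ->
        2 * `|w| <= `|(fiber_poly f z).[w]| ].
Proof.
move=> [d d2 H]; have [a0 b0] := extends_leading d2 H.
have bd (c : nat -> C) n : exists2 B : R, 0 <= B & forall j, (j < n)%N -> `|c j| <= toC B.
  elim: n => [|n [B B0 hB]]; first by exists 0.
  have [x x0 xE] := norm_toC (c n).
  exists (Num.max B x); first by rewrite le_max B0.
  move=> j; rewrite ltnS leq_eqVlt => /predU1P[->|/hB jB].
    by rewrite xE toC_le le_max lexx orbT.
  by rewrite (le_trans jB)// toC_le le_max lexx.
have [c c0 hc] := bd (fun j => (base f)`_j) d.
have [M1 M10 h1] := escape_radius d2 a0 c0.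
have [B B0 hB] : exists2 B : R, 0 <= B & forall j, (j < d)%N ->
    forall z, `|z| <= toC M1 -> `|((fiber f)`_j).[z]| <= toC B.
  elim: {+}d => [|n [B B0 hB]]; first by exists 0.
  have [x x0 xE] := poly_bounded (fiber f)`_n M1.
  exists (Num.max B x); first by rewrite le_max B0.
  move=> j; rewrite ltnS leq_eqVlt => /predU1P[->|/hB jB] z zM.
    by rewrite (le_trans (xE z zM))// toC_le le_max lexx orbT.
  by rewrite (le_trans (jB z zM))// toC_le le_max lexx.
have [M2 M20 h2] := escape_radius d2 b0 B0.
exists M1, M2; split; [exact: ltW|exact: ltW| |].
  by apply: h1 => //; rewrite (extends_size_base d2 H).
move=> z w zM; have [s l] := extends_fiber_poly z d2 H.
by apply: h2 => //; [rewrite s|move=> j jd; rewrite fiber_polyE hB].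
Qed.

End SkewProduct.

(** * Iterates, the chain rule, and pullback of boundaries *)

Section Iteration.
Variable R : realType.
Local Notation C := (cplx R).
Implicit Types (z w : C) (p : {poly C}) (f : poly_skew R).

Lemma horner_poly_iter p n z : (poly_iter p n).[z] = iter n (horner p) z.
Proof. by elim: n => [|n IH]; rewrite /poly_iter /= ?hornerX// horner_comp IH. Qed.

Lemma deriv_poly_iter p n z :
  (poly_iter p n)^`().[z] = \prod_(k < n) p^`().[iter k (horner p) z].
Proof.
elim: n => [|n IH]; first by rewrite big_ord0 derivX hornerC.
rewrite big_ord_recr -IH /= deriv_comp hornerM horner_comp mulrC.
by rewrite -/(poly_iter p n) horner_poly_iter.
Qed.

Lemma iter_skew_map f n z w : iter n (skew_map f) (z, w) =
  (iter n (horner (base f)) z, (fiber_iter f n z).[w]).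
Proof.
elim: n => [|n IH] /=; first by rewrite hornerX.
by rewrite IH /skew_map /= horner_comp.
Qed.

Lemma iter_skew_map1 f n x : (iter n (skew_map f) x).1 = iter n (horner (base f)) x.1.
Proof. by case: x => z w; rewrite iter_skew_map. Qed.

Lemma deriv_fiber_iter f n z w : (fiber_iter f n z)^`().[w] =
  \prod_(k < n) let x := iter k (skew_map f) (z, w) in (fiber_poly f x.1)^`().[x.2].
Proof.
elim: n => [|n IH]; first by rewrite big_ord0 derivX hornerC.
by rewrite big_ord_recr -IH /= deriv_comp hornerM horner_comp mulrC iter_skew_map.
Qed.

Lemma cvg_horner2 (Q : {poly {poly C}}) (T : Type) (F : set_system T)
    {FF : Filter F} (a b : T -> C) (a0 b0 : C) :
  a t @[t --> F] --> a0 -> b t @[t --> F] --> b0 ->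
  (map_poly (horner_eval (a t)) Q).[b t] @[t --> F] -->
    (map_poly (horner_eval a0) Q).[b0].
Proof.
move=> ha hb; have E (u v : C) : (map_poly (horner_eval u) Q).[v] =
    \sum_(i < size Q) (Q`_i).[u] * v ^+ i.
  rewrite (horner_coef_wide _ (size_poly _ _)); apply: eq_bigr => i _.
  by rewrite coef_map.
rewrite E; under eq_fun do rewrite E.
apply: (@cvg_sum_ord C _ F FF _ (fun i t => (Q`_i).[a t] * b t ^+ i)
  (fun i => (Q`_i).[a0] * b0 ^+ i)) => i.
have h1 := @cvg_horner C _ F FF Q`_i a a0 ha.
have h2 := @cvg_powr C _ F FF i b b0 hb.
exact: (cvgM h1 h2).
Qed.

Lemma continuous_horner2 (Q : {poly {poly C}}) :
  continuous (fun x : C * C => (map_poly (horner_eval x.1) Q).[x.2] : C).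
Proof.
move=> x; apply: (@cvg_horner2 Q _ (nbhs x) _ fst snd x.1 x.2).
  exact: cvg_fst.
exact: cvg_snd.
Qed.

Lemma continuous_skew_map f : continuous (skew_map f).
Proof.
move=> x.
have h1 : (base f).[t.1] @[t --> nbhs x] --> (base f).[x.1].
  by apply: (@cvg_horner C _ (nbhs x) _ (base f) fst x.1); exact: cvg_fst.
exact: (cvg_pair h1 (@continuous_horner2 (fiber f) x)).
Qed.

Lemma continuous_iter (T : topologicalType) (g : T -> T) n :
  continuous g -> continuous (iter n g).
Proof.
move=> cg; elim: n => [|n IH] x /=; first by [].
exact: (continuous_comp (IH x) (cg _)).
Qed.

(** By the chain rule the derivative is a product of factors polynomial in the points of the orbit,
    whence joint continuity in the base and fiber variables. *)
Lemma continuous_deriv_fiber_iter f n :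
  continuous (fun x : C * C => (fiber_iter f n x.1)^`().[x.2] : C).
Proof.
rewrite [X in continuous X](_ : _ = fun y : C * C => \prod_(k < n)
    let x := iter k (skew_map f) y in
    (map_poly (horner_eval x.1) (fiber f)^`()).[x.2] : C); last first.
  apply/funext => y; rewrite deriv_fiber_iter -surjective_pairing.
  by apply: eq_bigr => k _; rewrite /fiber_poly -deriv_map.
move=> x; pose h k y := let x := iter k (skew_map f) y in
  (map_poly (horner_eval x.1) (fiber f)^`()).[x.2].
apply: (@cvg_prod_ord C _ (nbhs x) _ n h (fun k => h k x)) => k.
have h1 : {for x, continuous (iter k (skew_map f))}.
  exact: (continuous_iter (@continuous_skew_map f)).
exact: (continuous_comp h1 (@continuous_horner2 (fiber f)^`() (iter k (skew_map f) x))).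
Qed.

Lemma closed_orbit_bound (T : topologicalType) (g : nat -> T -> C) (M : R) :
  (forall n, continuous (g n)) -> closed [set x | forall n, `|g n x| <= toC M].
Proof.
move=> cg; have -> : [set x | forall n, `|g n x| <= toC M] =
    \bigcap_n (g n @^-1` [set z | `|z| <= toC M]).
  by rewrite eqEsubset; split => [x h n _|x h n]; [exact: h|exact: (h n)].
apply: closed_bigI => n _; apply: preimage_closed; last exact: closed_disk_closed.
by move=> x _; exact: cg.
Qed.

Lemma boundary_closed (T : topologicalType) (A : set T) : closed (boundary A).
Proof.
by apply: closedI; [exact: closed_closure|exact/open_closedC/open_interior].
Qed.

Lemma boundary_closedE (T : topologicalType) (A : set T) x : closed A ->
  boundary A x <-> A x /\ ~ A° x.
Proof.
by move=> cA; split=> -[Ax iA]; split=> //; [exact: cA|exact: subset_closure].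
Qed.

(** Continuity pulls interior points of [B] back to interior points of [A], and openness of [p]
    pushes those of [A] forward. *)
Lemma horner_boundary p (A B : set C) z : (1 < size p)%N -> closed A -> closed B ->
  (forall u, A u <-> B p.[u]) -> boundary A z <-> boundary B p.[z].
Proof.
move=> sp cA cB AB.
have [hA hA'] := boundary_closedE z cA; have [hB hB'] := boundary_closedE p.[z] cB.
split=> [/hA|/hB] [Az iA]; [apply: hB'|apply: hA']; split.
- exact: (AB z).1.
- move=> iB; apply: iA.
  have h : nbhs z (horner p @^-1` B) by exact: horner_continuous.
  by apply: filterS h => u; exact: (AB u).2.
- exact: (AB z).2.
- move=> iA'; apply: iA; have := horner_open sp iA'.
  by apply: filterS => _ [u Au <-]; exact: (AB u).1.
Qed.

End Iteration.

(** * Closedness and invariance of the filled Julia sets; slices of J_2 *)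

Section FilledJulia.
Variables (R : realType) (f : poly_skew R).
Hypothesis hf : is_poly_skew_product f.
Local Notation C := (cplx R).
Local Notation p := (base f).
Implicit Types (z w : C) (x : C * C).

Lemma size_base_gt1 : (1 < size p)%N.
Proof. by have [d d2 H] := hf; rewrite (extends_size_base d2 H) ltnS ltnW. Qed.

Lemma size_fiber_poly_gt1 z : (1 < size (fiber_poly f z))%N.
Proof.
by have [d d2 H] := hf; rewrite (extends_fiber_poly z d2 H).1 ltnS ltnW.
Qed.

(** Bounds that no longer depend on the orbit turn the filled Julia sets into intersections of
    closed conditions. The base coordinate is trapped first, since the fiber radius [M2] is valid
    only over the disk of radius [M1]. *)
Lemma filled_julia_bounds : exists M1 M2 : R, [/\ 0 <= M1, 0 <= M2,
  forall z, filled_julia p z <-> forall n, `|iter n (horner p) z| <= toC M1,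
  forall x, filled_julia2 f x <-> filled_julia p x.1 /\
    forall n, `|(iter n (skew_map f) x).2| <= toC M2 &
  forall z w, filled_julia p z -> toC M2 < `|w| -> 2 * `|w| <= `|(fiber_poly f z).[w]| ].
Proof.
have [M1 [M2 [M10 M20 h1 h2]]] := escape_radii hf.
have K1 z : filled_julia p z <-> forall n, `|iter n (horner p) z| <= toC M1.
  split=> [[M hM]|h]; last by exists M1.
  by apply: (doubling_trapped M10 hM) => n; exact: h1.
exists M1, M2; split => //; last by move=> z w /K1/(_ 0%N) zM; exact: h2.
move=> x; split=> [[M hM]|[/K1 hx1 hx2]]; last first.
  exists (Num.max M1 M2) => n; rewrite prod_normE /= iter_skew_map1.
  rewrite /Num.max; case: ifPn => _.
    by rewrite (le_trans (hx2 n))// toC_le le_max lexx orbT.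
  by rewrite (le_trans (hx1 n))// toC_le le_max lexx.
have hM1 n : `|(iter n (skew_map f) x).1| <= toC M.
  apply: le_trans (hM n); rewrite prod_normE /= /Num.max; case: ifPn => //.
  exact: ltW.
have hM2 n : `|(iter n (skew_map f) x).2| <= toC M.
  apply: le_trans (hM n); rewrite prod_normE /= /Num.max; case: ifPn => //.
  by rewrite -norm_leNgt.
have x1 : filled_julia p x.1.
  by exists M => n; rewrite -iter_skew_map1.
split=> //; apply: (doubling_trapped M20 hM2) => n /= /h2; apply.
by rewrite iter_skew_map1; exact: (K1 _).1.
Qed.

Lemma closed_filled_julia : closed (filled_julia p).
Proof.
have [M1 [M2 [_ _ h _ _]]] := filled_julia_bounds.
have -> : filled_julia p = [set z | forall n, `|iter n (horner p) z| <= toC M1].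
  by rewrite eqEsubset; split => z /h.
by apply: closed_orbit_bound => n; apply: continuous_iter; exact: horner_continuous.
Qed.

Lemma closed_filled_julia2 : closed (filled_julia2 f).
Proof.
have [M1 [M2 [_ _ h1 h2 _]]] := filled_julia_bounds.
have -> : filled_julia2 f = (fst @^-1` filled_julia p) `&`
    [set x | forall n, `|(iter n (skew_map f) x).2| <= toC M2].
  by rewrite eqEsubset; split => x /h2.
apply: closedI.
  by apply: preimage_closed closed_filled_julia => x _; exact: cvg_fst.
apply: (@closed_orbit_bound R _ (fun n x => (iter n (skew_map f) x).2)) => n x.
have cn : {for x, continuous (iter n (skew_map f))}.
  exact: (continuous_iter (@continuous_skew_map _ f)).
have cs : {for iter n (skew_map f) x, continuous (@snd C C)} by exact: cvg_snd.
exact: (continuous_comp cn cs).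
Qed.

Lemma closed_fiber_filled_julia z : closed (fiber_filled_julia f z).
Proof.
apply: (@preimage_closed _ _ (fun w => (z, w))); last exact: closed_filled_julia2.
move=> w _; have hz : z @[_ --> nbhs w] --> z by exact: cvg_cst.
exact: (cvg_pair hz (@cvg_id _ (nbhs w))).
Qed.

Lemma filled_julia_horner z : filled_julia p z <-> filled_julia p p.[z].
Proof.
have [M1 [M2 [_ _ h1 _ _]]] := filled_julia_bounds; split => [/h1 h|].
  by apply/h1 => n; rewrite -iterSr.
move=> [M hM]; have [x x0 xE] := norm_toC z.
exists (Num.max M x) => -[|n].
  by rewrite /= xE toC_le le_max lexx orbT.
by rewrite iterSr (le_trans (hM n))// toC_le le_max lexx.
Qed.

Lemma fiber_filled_julia_horner z w :
  fiber_filled_julia f z w <-> fiber_filled_julia f p.[z] (fiber_poly f z).[w].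
Proof.
split=> -[M hM].
  by exists M => n; rewrite (_ : (_, _) = skew_map f (z, w))// -iterSr.
have [x x0 xE] : exists2 x, 0 <= x & `|(z, w)| = toC x.
  have [x x0 xE] := norm_toC z; have [y y0 yE] := norm_toC w.
  by rewrite prod_normE /= /Num.max; case: ifPn => _; [exists y|exists x].
exists (Num.max M x) => -[|n].
  by rewrite /= xE toC_le le_max lexx orbT.
by rewrite iterSr (le_trans (hM n))// toC_le le_max lexx.
Qed.

Lemma julia_horner z : julia p z <-> julia p p.[z].
Proof.
apply: horner_boundary; [exact: size_base_gt1|exact: closed_filled_julia..|].
exact: filled_julia_horner.
Qed.

Lemma fiber_julia_horner z w :
  fiber_julia f z w <-> fiber_julia f p.[z] (fiber_poly f z).[w].
Proof.
apply: horner_boundary; [exact: size_fiber_poly_gt1|exact: closed_fiber_filled_julia..|].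
exact: fiber_filled_julia_horner.
Qed.

Lemma julia_filled z : julia p z -> filled_julia p z.
Proof. by case=> h _; exact: closed_filled_julia. Qed.

Lemma fiber_julia_filled z w : fiber_julia f z w -> fiber_filled_julia f z w.
Proof. by case=> h _; exact: closed_fiber_filled_julia. Qed.

Lemma julia2_base x : julia2 f x -> julia p x.1.
Proof.
have : closed (fst @^-1` julia p : set (C * C)).
  apply: preimage_closed; last exact: boundary_closed.
  by move=> y _; exact: cvg_fst.
move=> cl J2x; apply: cl; move: J2x; apply: closure_subset.
by move=> y [z Jz [/= -> _]].
Qed.

Lemma julia2_filled x : julia2 f x -> filled_julia2 f x.
Proof.
move=> J2x; apply: closed_filled_julia2; move: J2x; apply: closure_subset.
by move=> [a b] [z Jz [/= -> /fiber_julia_filled]].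
Qed.

Lemma julia2_compact : compact (julia2 f).
Proof.
have [M1 [M2 [_ _ h1 h2 _]]] := filled_julia_bounds.
apply: (@compact_prod_bounded _ _ (Num.max M1 M2)); first exact: closed_closure.
move=> x /julia2_filled/h2[/h1/(_ 0%N) /= x1 /(_ 0%N) /= x2].
rewrite prod_normE /Num.max; case: ifPn => _.
  by rewrite (le_trans x2)// toC_le le_max lexx orbT.
by rewrite (le_trans x1)// toC_le le_max lexx.
Qed.

(* Vertical expansion passes to the closure J_2, whereas at an interior point
   of K_z Cauchy's estimate bounds the derivatives of all iterates. *)
Lemma julia2_slice z : vertically_expanding f (julia p) -> julia p z ->
  [set z] `*` fiber_julia f z = julia2 f `&` vertical_line z.
Proof.
move=> [c [L [c0 L1 hL]]] Jz; rewrite eqEsubset; split.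
  move=> x [xz Jx]; split; last by split.
  by apply: subset_closure; exists z.
move=> [z' w] [J2 [/= zz _]]; move: zz J2 => -> J2; split; first by [].
rewrite /= {z'}.
have [M1 [M2 [_ _ h1 h2 _]]] := filled_julia_bounds.
have Kw : fiber_filled_julia f z w by exact: julia2_filled.
split; first exact: (subset_closure Kw).
(* Halving the radius puts the closed disk needed for Cauchy's estimate inside K_z. *)
move=> /nbhs_normC[e e0 eK]; pose e' := e / 2.
have e'0 : 0 < e' by rewrite divr_gt0.
have up n : `|(fiber_iter f n z)^`().[w]| <= toC M2 / toC e'.
  apply: deriv_bound; first by rewrite -toC0 toC_lt.
  move=> u uw; have /h2[_ /(_ n)] : filled_julia2 f (z, u).
    apply: eK; apply: le_lt_trans uw _; rewrite toC_lt /e'.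
    by rewrite ltr_pdivrMr// ltr_pMr// ltr1n.
  by rewrite iter_skew_map.
(* The point [(z, w)] is a limit of points of fiber Julia sets over J_p, where the bound holds, and
   the derivative is continuous in both variables. *)
have low n : (1 <= n)%N -> toC (c * L ^+ n) <= `|(fiber_iter f n z)^`().[w]|.
  move=> n1; rewrite real_leNgt ?normr_real//; last first.
    by rewrite realE -toC0 !toC_le le_total.
  have [x x0 xE] := norm_toC (fiber_iter f n z)^`().[w].
  apply/negP; rewrite xE toC_lt => xL.
  have := @continuous_deriv_fiber_iter _ f n (z, w).
  move=> /(_ [set u : C | `|u - (fiber_iter f n z)^`().[w]| < toC (c * L ^+ n - x)]).
  have nb : nbhs (fiber_iter f n z)^`().[w]
      [set u : C | `|u - (fiber_iter f n z)^`().[w]| < toC (c * L ^+ n - x)].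
    by apply/nbhs_normC; exists (c * L ^+ n - x); rewrite ?subr_gt0.
  move=> /(_ nb)/J2[[a b] [[a' Ja' [/= -> Jb]]]] /=.
  have := hL a' b n Ja' Jb n1; set s := (fiber_iter f n a')^`().[b] => sL sx.
  have : `|s| <= toC x + `|s - (fiber_iter f n z)^`().[w]|.
    by rewrite -xE -{1}[s](subrK (fiber_iter f n z)^`().[w]) addrC ler_normD.
  move/(le_trans sL)/le_lt_trans/(_ (ler_ltD (lexx _) sx)).
  by rewrite -toCD addrC subrK toC_lt ltxx.
have [n] := expr_gt (M2 / e' / c) L1.
(* Expansion is available only from [n = 1]. If the chosen exponent is 0, the upper bound is already
   below [c], and the case [n = 1] gives [c * L <= c], contradicting [1 < L]. *)
have [n0|n0] := posnP n.
  rewrite n0 expr0 => h.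
  have : toC (c * L ^+ 1) <= toC (M2 / e').
    by rewrite (toCM M2) toCV; exact: le_trans (low 1%N isT) (up 1%N).
  rewrite toC_le expr1 => h'; move: h; rewrite ltr_pdivrMr// mul1r => h.
  have : c * L <= c by rewrite (le_trans h')// ltW.
  by rewrite ger_pMr// leNgt L1.
rewrite ltr_pdivrMr// [_ * c]mulrC => h.
have : toC (c * L ^+ n) <= toC (M2 / e').
  by rewrite (toCM M2) toCV; exact: le_trans (low n n0) (up n).
by rewrite toC_le leNgt h.
Qed.

End FilledJulia.

(** * Nonemptiness of the fiber Julia sets *)

Section FiberJulia.
Variables (R : realType) (f : poly_skew R).
Hypothesis hf : is_poly_skew_product f.
Local Notation C := (cplx R).
Local Notation p := (base f).
Implicit Types (z w : C) (x : C * C).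

Lemma size_fiber_iter_gt1 n z : (1 < size (fiber_iter f n z))%N.
Proof.
elim: n => [|n IH]; first by rewrite size_polyX.
have := size_comp_poly (fiber_poly f (iter n (horner p) z)) (fiber_iter f n z).
have := size_fiber_poly_gt1 hf (iter n (horner p) z); rewrite /=.
move: IH; case: (size _) => // -[|a] // _; case: (size _) => // -[|b] // _ /=.
by rewrite mulSn; case: (size _) => [|[|]].
Qed.

Lemma filled_julia_iter n z :
  filled_julia p z -> filled_julia p (iter n (horner p) z).
Proof. by move=> Kz; elim: n => //= n IH; exact: (filled_julia_horner hf _).1. Qed.

(* A limit of points w_n with Q_z^n(w_n) = 0 has a bounded orbit, because an
   orbit that leaves the escape disk never returns. *)
Lemma fiber_filled_julia_nonempty z : filled_julia p z ->
  exists w, fiber_filled_julia f z w.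
Proof.
move=> Kz; have [M1 [M2 [_ M20 _ h2 h3]]] := filled_julia_bounds hf.
have [w wE] := choice (fun n => horner_root_surj 0 (size_fiber_iter_gt1 n z)).
have wn n k : (k <= n)%N -> `|(fiber_iter f k z).[w n]| <= toC M2.
  move=> kn; rewrite norm_le_toC; apply/negP => wk.
  have H m : toC M2 < `|(fiber_iter f (m + k) z).[w n]|.
    elim: m => // m IH; rewrite addSn /= horner_comp.
    have := h3 _ _ (filled_julia_iter (m + k) Kz) IH; apply: lt_le_trans.
    by apply: (lt_le_trans IH); rewrite ler_peMl// ler1n.
  by have := H (n - k)%N; rewrite subnK// wE normr0 -toC0 toC_lt ltNge M20.
have [|w0 [_ cl]] := @closed_disk_compact R M2 (w @ \oo) _.
  by exists 0%N => // n _; have := wn n 0%N isT; rewrite /= hornerX.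
exists w0; apply/h2; split=> // n; rewrite iter_skew_map /=.
(* For fixed [n] the bound holds at every [w m] with [n <= m]; as a closed condition it passes to
   the cluster point. *)
have : closed [set u : C | `|(fiber_iter f n z).[u]| <= toC M2].
  apply: (@preimage_closed _ _ (horner (fiber_iter f n z)) [set u : C | `|u| <= toC M2]).
    by move=> u _; exact: horner_continuous.
  exact: closed_disk_closed.
apply; move: cl; rewrite clusterE; apply.
by exists n => // m /= nm; exact: wn.
Qed.

(** If J_z were empty, K_z would be open as well as closed, and the segment from one of its points
    to a point [b] beyond the escape radius would stay in it. *)
Lemma fiber_julia_nonempty z : filled_julia p z -> exists w, fiber_julia f z w.
Proof.
move=> Kz; have [a Ka] := fiber_filled_julia_nonempty Kz.
have [M1 [M2 [_ M20 _ h2 _]]] := filled_julia_bounds hf.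
have cK : closed (fiber_filled_julia f z) by exact: closed_fiber_filled_julia.
apply: contrapT => noJ; pose b : C := toC (M2 + 1).
suff : fiber_filled_julia f z b.
  move=> /h2[_ /(_ 0%N)] /=; rewrite norm_toCE toC_le ger0_norm; first lra.
  by rewrite addr_ge0.
apply: (segment_clopen _ Ka) => t _; set u := a + _.
have [Ku|Ku] := pselect (fiber_filled_julia f z u); last first.
  by right; apply: open_nbhs_nbhs; split; [exact: closed_openC|exact: Ku].
left; apply: contrapT => iu; apply: noJ; exists u.
by apply: (boundary_closedE u cK).2; split; [exact: Ku|exact: iu].
Qed.

Lemma julia2_sliceE z w : vertically_expanding f (julia p) -> julia p z ->
  julia2 f (z, w) <-> fiber_julia f z w.
Proof.
move=> hv Jz; have E := julia2_slice hf hv Jz; split=> J.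
  have : (julia2 f `&` vertical_line z) (z, w) by exact: (conj J (conj erefl I)).
  by rewrite -E => -[_ J']; exact: J'.
have : ([set z] `*` fiber_julia f z) (z, w) by exact: (conj erefl J).
by rewrite E => -[J' _]; exact: J'.
Qed.

End FiberJulia.

(** * Counting preimages to bound the degree *)

Section Degree.
Variables (R : realType).
Local Notation C := (cplx R).
Implicit Types (f : poly_skew R).

Lemma julia2_skew_map f x : is_poly_skew_product f ->
  vertically_expanding f (julia (base f)) -> julia2 f x -> julia2 f (skew_map f x).
Proof.
case: x => z w hf hv J2; have Jz : julia (base f) z := julia2_base J2.
apply: (julia2_sliceE hf _ hv ((julia_horner hf z).1 Jz)).2.
exact: ((fiber_julia_horner hf z w).1 ((julia2_sliceE hf w hv Jz).1 J2)).
Qed.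

Lemma hyperbolic_deriv_neq0 (p : {poly C}) z :
  hyperbolic p -> julia p z -> p^`().[z] != 0.
Proof.
move=> [c [L [c0 L1 h]]] Jz; have := h z 1%N Jz isT.
rewrite deriv_poly_iter big_ord1 /= expr1 => cL; rewrite -normr_gt0.
by apply: lt_le_trans cL; rewrite -toC0 toC_lt mulr_gt0// (lt_trans _ L1).
Qed.

(** The preimages of the base point lie in J_p, hence are simple roots and number deg p. One
    solution [w] over each suffices: the pairs are already distinguished by their first coordinates,
    and they lie in J_2 by backward invariance. *)
Lemma julia2_preimages f y : is_poly_skew_product f -> hyperbolic (base f) ->
  vertically_expanding f (julia (base f)) -> julia2 f y ->
  exists s : seq (C * C), [/\ uniq s, size s = (size (base f)).-1 &
    forall x, x \in s -> julia2 f x /\ skew_map f x = y].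
Proof.
case: y => z' w' hf hh hv J2y; pose p := base f; pose q := p - z'%:P.
have Jz' : julia p z' := julia2_base J2y.
have sp : (1 < size p)%N := size_base_gt1 hf.
have sq : size q = size p.
  by rewrite size_polyDl// size_polyN (leq_ltn_trans (size_polyC_leq1 _)).
have rq r : root q r = (p.[r] == z').
  by rewrite rootE hornerD hornerN hornerC subr_eq0.
have q0 : q != 0 by rewrite -size_poly_eq0 sq; case: (size p) sp.
have Jr r : p.[r] = z' -> julia p r by move=> rz; apply: (julia_horner hf r).2; rewrite rz.
have [|s [us ss sE]] := simple_roots_seq q0.
  move=> r; rewrite rq => /eqP /Jr Jr'.
  by rewrite derivB derivC subr0 rootE hyperbolic_deriv_neq0.
have [w wE] := choice (fun r => horner_root_surj w' (size_fiber_poly_gt1 hf r)).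
exists [seq (r, w r) | r <- s]; split.
- by rewrite map_inj_uniq// => r1 r2 [].
- by rewrite size_map ss sq.
move=> _ /mapP[r rs ->]; move: rs; rewrite sE rq => /eqP rz.
split; last by rewrite /skew_map /= wE rz.
apply: (julia2_sliceE hf _ hv (Jr r rz)).2.
apply: (fiber_julia_horner hf r (w r)).2; rewrite wE rz.
exact: (julia2_sliceE hf w' hv Jz').1.
Qed.

Lemma skew_preimages_finite f y : is_poly_skew_product f ->
  exists s : seq (C * C), forall x, skew_map f x = y -> x \in s.
Proof.
case: y => z' w' hf.
have [s hs] := horner_preimage_seq z' (size_base_gt1 hf).
have [t ht] := choice (fun r => horner_preimage_seq w' (size_fiber_poly_gt1 hf r)).
exists [seq (r, w) | r <- s, w <- t r] => -[z w] [zE wE].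
by apply/allpairsPdep; exists z, w; rewrite hs// ht.
Qed.

(* A conjugacy carries the preimages in J_2 of a point y to those of its image,
   and f_l has at least deg p_l preimages of any point of J_2(f_l). *)
Lemma conjugate_degree_bound f g (Phi : C * C -> C * C) y :
  is_poly_skew_product f -> vertically_expanding f (julia (base f)) ->
  is_poly_skew_product g -> hyperbolic (base g) ->
  vertically_expanding g (julia (base g)) ->
  set_inj (julia2 f) Phi -> Phi @` julia2 f = julia2 g ->
  (forall x, julia2 f x -> skew_map g (Phi x) = Phi (skew_map f x)) ->
  forall s : seq (C * C), (forall x, skew_map f x = y -> x \in s) ->
  julia2 f y -> ((size (base g)).-1 <= size s)%N.
Proof.
move=> hf hvf hg hhg hvg inj im conj s hs Jy.
have JPy : julia2 g (Phi y) by rewrite -im; exists y.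
have [t [ut st ht]] := julia2_preimages hg hhg hvg JPy.
(* [psi] is a section of [Phi] over [t]; its values elsewhere are irrelevant. *)
have /choice[psi psiE] x : exists x0, x \in t -> julia2 f x0 /\ Phi x0 = x.
  have [xt|] := boolP (x \in t); last by exists x.
  have [] := ht x xt; rewrite -im => -[x0 J0 x0E] _; by exists x0.
rewrite -st -(size_map psi t); apply: uniq_leq_size.
  apply: (@map_uniq _ _ Phi); rewrite -map_comp (_ : map _ _ = t)//.
  rewrite -[RHS]map_id; apply/eq_in_map => x xt; exact: (psiE x xt).2.
move=> _ /mapP[x xt ->]; apply: hs; have [J0 x0E] := psiE x xt.
apply: inj; [exact: (mem_set (julia2_skew_map hf hvf J0))|exact: (mem_set Jy)|].
by rewrite -conj// x0E; exact: (ht x xt).2.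
Qed.

End Degree.

(** * Expansiveness along a motion *)

Section DifferenceQuotient.
Variable K : numFieldType.
Implicit Types (q : {poly K}) (a b : K).

(* n only has to bound the size of q; it is fixed so that the sum keeps the same
   length along a family of polynomials. *)
Definition diff_quot n q a b : K :=
  \sum_(i < n) q`_i * \sum_(k < i) a ^+ (i.-1 - k) * b ^+ k.

(** The difference quotient of the N-th iterate of [q], factored along the two orbits; on the
    diagonal the factors become those of the chain rule. *)
Definition diff_quot_iter n N q a b : K :=
  \prod_(k < N) diff_quot n q (iter k (horner q) a) (iter k (horner q) b).

Lemma diff_quotP n q a b : (size q <= n)%N ->
  q.[a] - q.[b] = (a - b) * diff_quot n q a b.
Proof.
move=> sq; rewrite !(horner_coef_wide _ sq) -sumrB mulr_sumr.
by apply: eq_bigr => i _; rewrite -mulrBr subrXX mulrCA.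
Qed.

Lemma diff_quot_diag n q a : (size q <= n)%N -> diff_quot n q a a = q^`().[a].
Proof.
move=> sq; have -> : q = \sum_(i < n) q`_i *: 'X^i.
  rewrite -poly_def; apply/polyP => i; rewrite coef_poly.
  by case: ltnP => // ni; rewrite nth_default// (leq_trans sq).
rewrite /diff_quot raddf_sum horner_sum; apply: eq_bigr => i _ /=.
rewrite derivZ derivXn hornerZ hornerMn hornerXn -poly_def coef_poly ltn_ord.
congr (_ * _); rewrite (eq_bigr (fun=> a ^+ i.-1)) => [|k _].
  by rewrite sumr_const card_ord.
by rewrite -exprD subnK// -ltnS prednK//; case: (nat_of_ord i) k => // -[].
Qed.

Lemma diff_quot_iterP n N q a b : (size q <= n)%N ->
  iter N (horner q) a - iter N (horner q) b = (a - b) * diff_quot_iter n N q a b.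
Proof.
move=> sq; elim: N => [|N IH]; first by rewrite /diff_quot_iter big_ord0 mulr1.
by rewrite /= (diff_quotP _ _ sq) IH /diff_quot_iter big_ord_recr /= mulrA.
Qed.

Variables (T : Type) (F : set_system T).
Context {FF : Filter F}.

Lemma cvg_diff_quot_iter n N (q : T -> {poly K}) (a b : T -> K) q0 a0 b0 :
  (forall t, size (q t) <= n)%N -> (size q0 <= n)%N ->
  (forall i, (q t)`_i @[t --> F] --> q0`_i) ->
  a t @[t --> F] --> a0 -> b t @[t --> F] --> b0 ->
  diff_quot_iter n N (q t) (a t) (b t) @[t --> F] --> diff_quot_iter n N q0 a0 b0.
Proof.
move=> sq sq0 hq ha hb.
have hit k (c : T -> K) c0 : c t @[t --> F] --> c0 ->
    iter k (horner (q t)) (c t) @[t --> F] --> iter k (horner q0) c0.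
  move=> hc; elim: k => //= k IH.
  rewrite (horner_coef_wide _ sq0); under eq_fun do rewrite (horner_coef_wide _ (sq _)).
  apply: (@cvg_sum_ord K T F FF n
    (fun i t => (q t)`_i * iter k (horner (q t)) (c t) ^+ i)
    (fun i => q0`_i * iter k (horner q0) c0 ^+ i)) => i.
  by apply: cvgM; [exact: hq|exact: cvg_powr].
apply: (@cvg_prod_ord K T F FF N
  (fun k t => diff_quot n (q t) (iter k (horner (q t)) (a t)) (iter k (horner (q t)) (b t)))
  (fun k => diff_quot n q0 (iter k (horner q0) a0) (iter k (horner q0) b0))) => k.
apply: (@cvg_sum_ord K T F FF n (fun i t => (q t)`_i *
    \sum_(j < i) iter k (horner (q t)) (a t) ^+ (i.-1 - j) * iter k (horner (q t)) (b t) ^+ j)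
  (fun i => q0`_i *
    \sum_(j < i) iter k (horner q0) a0 ^+ (i.-1 - j) * iter k (horner q0) b0 ^+ j)) => i.
apply: cvgM; first exact: hq.
apply: (@cvg_sum_ord K T F FF i (fun j t =>
    iter k (horner (q t)) (a t) ^+ (i.-1 - j) * iter k (horner (q t)) (b t) ^+ j)
  (fun j => iter k (horner q0) a0 ^+ (i.-1 - j) * iter k (horner q0) b0 ^+ j)) => j.
by apply: cvgM; apply: cvg_powr; exact: hit.
Qed.

End DifferenceQuotient.

(** Continuity on a product, restated for arbitrary filters so that parameter and point may vary
    together or one of them stay fixed. *)
Lemma cvg_within_setX (U V Y : topologicalType) (g : U -> V -> Y) (A : set U)
    (B : set V) (T : Type) (F : set_system T) {FF : Filter F} (u : T -> U) (v : T -> V) u0 v0 :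
  {within A `*` B, continuous (fun x : U * V => g x.1 x.2)} ->
  A u0 -> B v0 -> u t @[t --> F] --> u0 -> v t @[t --> F] --> v0 ->
  (\forall t \near F, A (u t) /\ B (v t)) ->
  g (u t) (v t) @[t --> F] --> g u0 v0.
Proof.
move=> cg Au Bv hu hv hAB W.
move=> /((subspace_continuousP _ _).1 cg (u0, v0) (conj Au Bv)).
move=> [[M N] [/= M1 N1] MN]; rewrite /=.
have hM : \forall t \near F, M (u t) := hu _ M1.
have hN : \forall t \near F, N (v t) := hv _ N1.
apply: filterS (filterI hAB (filterI hM hN)) => t [AB MNt].
exact: (MN (u t, v t) MNt AB).
Qed.

Section Expansiveness.
Variable R : realType.
Local Notation C := (cplx R).

Lemma cvg_norm_gt (T : Type) (F : set_system T) {FF : Filter F}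
    (h : T -> C) (l : C) (x : R) :
  h t @[t --> F] --> l -> toC x < `|l| -> \forall t \near F, toC x < `|h t|.
Proof.
have [y _ yE] := norm_toC l; rewrite yE toC_lt => hl xy.
apply: (hl [set u : C | toC x < `|u|]); apply/nbhs_normC.
exists (y - x); rewrite ?subr_gt0// => u ul /=.
have : `|l| - `|u| < toC (y - x).
  by apply: le_lt_trans ul; rewrite distrC; exact: lerB_dist.
by rewrite yE toCB ltrD2l ltrN2.
Qed.

(** Abstract setting: each [g l] semiconjugates [F0] on the compact set [J] to the polynomial [P l].
    In the application [g l x] is the first coordinate of [Phi l x]. *)
Variables (X : topologicalType) (J : set X) (F0 : X -> X) (g : C -> X -> C).
Variables (P : C -> {poly C}) (D : set C) (n : nat) (l0 : C).
Hypotheses (cJ : compact J) (JF0 : forall x, J x -> J (F0 x)).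
Hypotheses (D0 : nbhs l0 D) (sP : forall l, (size (P l) <= n)%N).
Hypothesis cP : forall i, (P l)`_i @[l --> l0] --> (P l0)`_i.
Hypothesis cg : {within D `*` J, continuous (fun u : C * X => g u.1 u.2)}.
Hypothesis gF0 : forall l x, D l -> J x -> g l (F0 x) = (P l).[g l x].
Hypothesis gbd : forall l x, D l -> J x -> bounded_orbit (horner (P l)) (g l x).

(* Expansiveness of p_l0: if two points have the same image at l0 then their
   orbits stay close for l near l0, uniformly in time; as p_l^N is expanding by a
   factor 2 between nearby orbits, they must coincide. *)
Lemma motion_eq_open (N : nat) :
  (forall x, J x -> toC 2 < `|(poly_iter (P l0) N)^`().[g l0 x]|) ->
  \forall l \near l0, forall x1 x2, J x1 -> J x2 ->
    g l0 x1 = g l0 x2 -> g l x1 = g l x2.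
Proof.
move=> hN; have Dl0 : D l0 := nbhs_singleton D0.
(* Compactness of [J * J] merges the neighborhoods of [l0] found at the individual pairs into a
   single one. *)
have near2 : \forall l \near l0, J `*` J `<=` [set x | g l0 x.1 = g l0 x.2 ->
    D l -> toC 2 < `|diff_quot_iter n N (P l) (g l x.1) (g l x.2)|].
  have cJJ := compact_setX cJ cJ; move/compact_near_coveringP: cJJ => H.
  (* Membership in [J] becomes a premise because the neighborhoods of a pair are taken in
     [X * X]. *)
  have {}H := H C (nbhs l0) (fun l x => J x.1 -> J x.2 -> g l0 x.1 = g l0 x.2 ->
    D l -> toC 2 < `|diff_quot_iter n N (P l) (g l x.1) (g l x.2)|) _.
  have {}H : \forall l \near l0, J `*` J `<=` [set x | J x.1 -> J x.2 ->
      g l0 x.1 = g l0 x.2 ->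
      D l -> toC 2 < `|diff_quot_iter n N (P l) (g l x.1) (g l x.2)|].
    apply: H => -[x1 x2] [/= J1 J2].
    pose W : set ((X * X) * C) := [set t | [/\ J t.1.1, J t.1.2 & D t.2]].
    pose F := within W (filter_prod (nbhs (x1, x2)) (nbhs l0)).
    have FF : Filter F by exact: within_filter.
    have FW : \forall t \near F, W t by exact: withinT.
    have h12 : t.1 @[t --> F] --> (x1, x2) by apply: cvg_within_filter; exact: cvg_fst.
    have h1 : t.1.1 @[t --> F] --> x1 by exact: (cvg_comp _ _ h12 cvg_fst).
    have h2 : t.1.2 @[t --> F] --> x2 by exact: (cvg_comp _ _ h12 cvg_snd).
    have h0 : t.2 @[t --> F] --> l0 by apply: cvg_within_filter; exact: cvg_snd.
    have hl0 : l0 @[_ --> F] --> l0 by exact: cvg_cst.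
    have W1 : \forall t \near F, D t.2 /\ J t.1.1 by apply: filterS FW => t [].
    have W2 : \forall t \near F, D t.2 /\ J t.1.2 by apply: filterS FW => t [].
    have V1 : \forall t \near F, D l0 /\ J t.1.1 by apply: filterS FW => t [].
    have V2 : \forall t \near F, D l0 /\ J t.1.2 by apply: filterS FW => t [].
    have g1 := @cvg_within_setX _ _ _ g D J _ F FF _ _ _ _ cg Dl0 J1 h0 h1 W1.
    have g2 := @cvg_within_setX _ _ _ g D J _ F FF _ _ _ _ cg Dl0 J2 h0 h2 W2.
    have k1 := @cvg_within_setX _ _ _ g D J _ F FF _ _ _ _ cg Dl0 J1 hl0 h1 V1.
    have k2 := @cvg_within_setX _ _ _ g D J _ F FF _ _ _ _ cg Dl0 J2 hl0 h2 V2.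
    suff : \forall t \near F, g l0 t.1.1 = g l0 t.1.2 ->
        toC 2 < `|diff_quot_iter n N (P t.2) (g t.2 t.1.1) (g t.2 t.1.2)|.
      move=> [AB hAB ABW]; exists AB => // -[[y1 y2] l] yl Jy1 Jy2 gy Dl.
      exact: (ABW (y1, y2, l) yl (And3 Jy1 Jy2 Dl) gy).
    (* If the images at [l0] differ, they differ at all nearby pairs and the claim is vacuous there.
       If they agree, the limiting quotient is the derivative of the N-th iterate, of modulus above
       2. *)
    have [gx|/eqP gx] := pselect (g l0 x1 = g l0 x2); last first.
      have gx0 : 0 < `|g l0 x1 - g l0 x2| by rewrite normr_gt0 subr_eq0.
      have hp : \forall t \near F, toC 0 < `|g l0 t.1.1 - g l0 t.1.2|.
        exact: (cvg_norm_gt (cvgB k1 k2) gx0).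
      apply: filterS hp => t ht gt.
      by move: ht; rewrite gt subrr normr0 toC0 ltxx.
    have cPt i : (P t.2)`_i @[t --> F] --> (P l0)`_i by 
      exact: (@cvg_comp _ _ _ snd (fun l => (P l)`_i) F (nbhs l0) _ h0 (@cP i)).
    have cE := @cvg_diff_quot_iter _ _ F FF n N (fun t => P t.2) _ _ _ _ _
      (fun t => sP t.2) (sP l0) cPt g1 g2.
    suff h : toC 2 < `|diff_quot_iter n N (P l0) (g l0 x1) (g l0 x2)|.
      have hp : \forall t \near F,
          toC 2 < `|diff_quot_iter n N (P t.2) (g t.2 t.1.1) (g t.2 t.1.2)|.
        exact: (cvg_norm_gt cE h).
      by apply: filterS hp.
    rewrite -gx /diff_quot_iter.
    rewrite (eq_bigr (fun k : 'I_N => (P l0)^`().[iter k (horner (P l0)) (g l0 x1)])).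
      by rewrite -deriv_poly_iter; exact: hN.
    by move=> k _; exact: diff_quot_diag.
  by apply: filterS H => l h x [Jx1 Jx2]; apply: h.
near=> l => x1 x2 J1 J2 gx.
have Dl : D l by near: l.
have E2 : J `*` J `<=` [set x | g l0 x.1 = g l0 x.2 ->
    D l -> toC 2 < `|diff_quot_iter n N (P l) (g l x.1) (g l x.2)|] by near: l.
have JF k x : J x -> J (iter k F0 x) by move=> Jx; elim: k => //= k; exact: JF0.
have gF k l' x : D l' -> J x -> g l' (iter k F0 x) = iter k (horner (P l')) (g l' x).
  by move=> Dl' Jx; elim: k => //= k <-; apply: gF0 => //; exact: JF.
(* The gap between the orbits every [N] steps. The images at [l0] of the two points remain equal
   under iteration of [F0], so the estimate [E2] applies at every time and the gap doubles. *)
pose u k := iter (k * N) (horner (P l)) (g l x1) - iter (k * N) (horner (P l)) (g l x2).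
have [M1 hM1] := gbd Dl J1; have [M2 hM2] := gbd Dl J2.
have uM k : `|u k| <= toC (M1 + M2).
  by rewrite (le_trans (ler_normB _ _))// toCD lerD.
have uu k : (0 <= k)%N -> 2 * `|u k| <= `|u k.+1|.
  move=> _; rewrite /u mulSn !iterD [X in _ <= `|X|](diff_quot_iterP N _ _ (sP l)).
  rewrite [leRHS]normrM mulrC ler_wpM2l// -!gF//; apply: ltW.
  have JJ : (J `*` J) (iter (k * N) F0 x1, iter (k * N) F0 x2).
    by split; exact: JF.
  have gk : g l0 (iter (k * N) F0 x1) = g l0 (iter (k * N) F0 x2) by rewrite !gF// gx.
  by rewrite -(toC_nat R 2); exact: (E2 _ JJ gk Dl).
by have := doubling_bounded uM uu; rewrite /u mul0n /= => /eqP; rewrite subr_eq0 => /eqP.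
Unshelve. all: by end_near.
Qed.

End Expansiveness.

(** * The motion of J_2 and its vertical fibers *)

Section MotionOfJ2.
Variable R : realType.
Local Notation C := (cplx R).

Lemma open_disk (r : R) : open (disk r : set C).
Proof.
rewrite openE => z /= zr; have [x _ xE] := norm_toC z.
move: zr; rewrite /disk /= xE toC_lt => xr.
apply/nbhs_normC; exists (r - x); rewrite ?subr_gt0// => u uz.
rewrite /disk /=; apply: le_lt_trans (_ : _ <= `|z| + `|u - z|) _.
  by rewrite -{1}[u](subrK z) addrC ler_normD.
by rewrite xE -ltrBrDl -toCB.
Qed.

Lemma disk_segment (r : R) (a b : C) (t : R) : 0 <= t <= 1 ->
  disk r a -> disk r b -> disk r (a + toC t * (b - a)).
Proof.
move=> /andP[t0 t1]; rewrite /disk /=.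
have [x x0 xE] := norm_toC a; have [y y0 yE] := norm_toC b.
rewrite xE yE (toC_lt x) (toC_lt y) => xr yr.
have -> : a + toC t * (b - a) = toC (1 - t) * a + toC t * b by rewrite toCB toC1; ring.
rewrite (le_lt_trans (ler_normD _ _))// !normrM !norm_toCE xE yE -!toCM -toCD.
rewrite toC_lt !ger0_norm ?subr_ge0//.
move: t0; rewrite le_eqVlt => /predU1P[<-|t0]; first lra.
have : t * y < t * r by rewrite ltr_pM2l.
have : (1 - t) * x <= (1 - t) * r by rewrite ler_wpM2l ?subr_ge0 // ltW.
lra.
Qed.

Lemma hyperbolic_iterate (p : {poly C}) (x : R) : hyperbolic p ->
  exists N, forall z, julia p z -> toC x < `|(poly_iter p N)^`().[z]|.
Proof.
move=> [c [L [c0 L1 h]]]; have [n hn] := expr_gt (x / c) L1.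
(* The successor ensures an exponent of at least 1, as the expansion estimate requires. *)
exists n.+1 => z Jz; apply: lt_le_trans (h z n.+1 Jz isT).
rewrite toC_lt mulrC -ltr_pdivrMr//; apply: lt_le_trans hn _.
by rewrite exprS ler_peMl ?exprn_ge0// ltW// (lt_trans _ L1).
Qed.

Variables (f : C -> poly_skew R) (r : R) (Phi : C -> C * C -> C * C).
Hypothesis f_hol : holomorphic_family f.
Hypothesis f_axiomA : forall l, disk 1 l -> axiomA (f l).
Hypotheses (r_gt0 : 0 < r) (r_le1 : r <= 1).
Hypothesis Phi_motion : julia2_motion r f Phi.

Let J := julia2 (f 0).

Lemma disk_sub1 l : disk r l -> disk 1 l.
Proof. by rewrite /disk /= => /lt_le_trans; apply; rewrite toC_le. Qed.

Lemma disk0 : disk r (0 : C).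
Proof. by rewrite /disk /= normr0 -toC0 toC_lt. Qed.

Lemma family_regular l : disk r l -> is_poly_skew_product (f l).
Proof. by move=> /disk_sub1; have [h _ _] := f_hol; exact: h. Qed.

Lemma family_hyperbolic l : disk r l -> hyperbolic (base (f l)).
Proof. by move=> /disk_sub1/f_axiomA[]. Qed.

Lemma family_vertically_expanding l : disk r l ->
  vertically_expanding (f l) (julia (base (f l))).
Proof. by move=> /disk_sub1/f_axiomA[]. Qed.

Lemma motion_julia2 l x : disk r l -> J x -> julia2 (f l) (Phi l x).
Proof. by move=> Dl Jx; have [_ /(_ l Dl)[<- _]] := Phi_motion; exists x. Qed.

Lemma motion_continuous :
  {within disk r `*` J, continuous (fun u : C * (C * C) => Phi u.1 u.2)}.
Proof. by have [[h _ _ _] _] := Phi_motion. Qed.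

Lemma motion0 x : J x -> Phi 0 x = x.
Proof. by have [[_ h _ _] _] := Phi_motion; exact: h. Qed.

Lemma motion_inj l x y : disk r l -> J x -> J y -> Phi l x = Phi l y -> x = y.
Proof.
have [[_ _ _ h] _] := Phi_motion => Dl Jx Jy.
exact: (h l Dl x y (mem_set Jx) (mem_set Jy)).
Qed.

Lemma motion_conj l x : disk r l -> J x ->
  skew_map (f l) (Phi l x) = Phi l (skew_map (f 0) x).
Proof. by move=> Dl Jx; have [_ /(_ l Dl)[_ h]] := Phi_motion; exact: h. Qed.

Lemma julia2_skew_map0 x : J x -> J (skew_map (f 0) x).
Proof.
apply: julia2_skew_map; first exact: (family_regular disk0).
exact: (family_vertically_expanding disk0).
Qed.

(** Holomorphy of each coefficient separately does not bound the degree along the family; the finite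
    number of preimages of [y] under f_0 does. *)
Lemma motion_degree_bound y : J y ->
  exists S, forall l, disk r l -> (size (base (f l)) <= S)%N.
Proof.
move=> Jy; have [s hs] := skew_preimages_finite y (family_regular disk0).
exists (size s).+1 => l Dl; have hl := family_regular Dl.
have [_ /(_ l Dl)[im _]] := Phi_motion.
have := @conjugate_degree_bound R (f 0) (f l) (Phi l) y (family_regular disk0)
  (family_vertically_expanding disk0) hl (family_hyperbolic Dl)
  (family_vertically_expanding Dl) _ im _ s hs Jy.
move=> H; have {}H : ((size (base (f l))).-1 <= size s)%N.
  apply: H; last by move=> x Jx; exact: motion_conj.
  by have [[_ _ _ h] _] := Phi_motion; exact: h.
by apply: leq_trans (leqSpred _) _; rewrite ltnS.
Qed.

Lemma base_coef_continuous l i : disk r l ->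
  (base (f m))`_i @[m --> l] --> (base (f l))`_i.
Proof.
move=> /disk_sub1 Dl; have [_ /(_ i l Dl) h _] := f_hol.
exact: (differentiable_continuous ((derivable1_diffP _ _).1 h)).
Qed.

Lemma motion_base_continuous :
  {within disk r `*` J, continuous (fun u : C * (C * C) => (Phi u.1 u.2).1 : C)}.
Proof.
apply/subspace_continuousP => x Dx.
have h := (subspace_continuousP _ _).1 motion_continuous x Dx.
exact: (cvg_comp _ _ h cvg_fst).
Qed.

Lemma motion_base_continuous_param l x : disk r l -> J x ->
  (Phi m x).1 @[m --> l] --> (Phi l x).1.
Proof.
move=> Dl Jx; have Dn : nbhs l (disk r).
  by apply: open_nbhs_nbhs; split; [exact: open_disk|exact: Dl].
have hm : m @[m --> l] --> l by [].
have hx : x @[_ --> l] --> x.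
  exact: (@cvg_cst _ x _ (nbhs l) (nbhs_filter l)).
apply: (@cvg_within_setX _ _ _ (fun l x => (Phi l x).1) (disk r) J
  _ (nbhs l) _ id (fun=> x) l x motion_base_continuous Dl Jx hm hx).
by apply: filterS Dn => m Dm; split.
Qed.

Lemma motion_base_eq_near l0 x1 x2 : disk r l0 -> J x1 -> J x2 ->
  (Phi l0 x1).1 = (Phi l0 x2).1 -> \forall l \near l0, (Phi l x1).1 = (Phi l x2).1.
Proof.
move=> Dl0 J1 J2 gx; have [S hS] := motion_degree_bound J1.
(* Truncation changes nothing for parameters in the disk, and makes the size bound hold for every
   parameter. *)
pose P l : {poly C} := \poly_(i < S) (base (f l))`_i.
have PE l : disk r l -> P l = base (f l).
  move=> Dl; apply/polyP => i; rewrite coef_poly; case: ltnP => // Si.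
  by rewrite nth_default// (leq_trans (hS l Dl)).
have Dn : nbhs l0 (disk r).
  by apply: open_nbhs_nbhs; split; [exact: open_disk|exact: Dl0].
have [N hN] := hyperbolic_iterate 2 (family_hyperbolic Dl0).
have cJ : compact J by apply: julia2_compact; exact: (family_regular disk0).
have sP l : (size (P l) <= S)%N by exact: size_poly.
have cP i : (P l)`_i @[l --> l0] --> (P l0)`_i.
  rewrite coef_poly; under eq_fun do rewrite coef_poly.
  case: ltnP => _; first exact: base_coef_continuous.
  exact: (@cvg_cst _ (0 : C) _ (nbhs l0) (nbhs_filter l0)).
have gF0 l x : disk r l -> J x -> (Phi l (skew_map (f 0) x)).1 = (P l).[(Phi l x).1].
  by move=> Dl Jx; rewrite PE// -motion_conj.
have gbd l x : disk r l -> J x -> bounded_orbit (horner (P l)) (Phi l x).1.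
  move=> Dl Jx; rewrite PE//; apply: julia_filled; first exact: family_regular.
  by apply: julia2_base; exact: motion_julia2.
have := @motion_eq_open R _ J (skew_map (f 0)) (fun l x => (Phi l x).1) P (disk r) S l0
  cJ julia2_skew_map0 Dn sP cP motion_base_continuous gF0 gbd N.
move=> H; have {}H : \forall l \near l0, forall x1 x2, J x1 -> J x2 ->
    (Phi l0 x1).1 = (Phi l0 x2).1 -> (Phi l x1).1 = (Phi l x2).1.
  apply: H => x Jx; rewrite PE//; apply: hN.
  by apply: julia2_base; exact: motion_julia2.
by apply: filterS H => l; apply.
Qed.

(* The parameters at which the two base points agree form a clopen subset of the
   disk. *)
Lemma motion_base_eq l m x1 x2 : disk r l -> disk r m -> J x1 -> J x2 ->
  (Phi l x1).1 = (Phi l x2).1 -> (Phi m x1).1 = (Phi m x2).1.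
Proof.
move=> Dl Dm J1 J2; pose E : set C := [set u | (Phi u x1).1 = (Phi u x2).1].
(* The disk is convex, so it suffices to examine the segment from [l] to [m]. *)
apply: (@segment_clopen R E) => t t01; have := disk_segment t01 Dl Dm.
set u := l + _ => Du.
have [ue|/eqP ue] := pselect ((Phi u x1).1 = (Phi u x2).1).
  by left; exact: motion_base_eq_near.
right; have g0 : 0 < `|(Phi u x1).1 - (Phi u x2).1| by rewrite normr_gt0 subr_eq0.
have h : \forall v \near u, toC 0 < `|(Phi v x1).1 - (Phi v x2).1|.
  exact: (cvg_norm_gt (cvgB (@motion_base_continuous_param u x1 Du J1)
    (@motion_base_continuous_param u x2 Du J2)) g0).
apply: filterS h => v hv ve; move: hv; rewrite (ve : (Phi v x1).1 = _).
by rewrite subrr normr0 toC0 ltxx.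
Qed.

Lemma fiber_julia_julia2 z w :
  julia (base (f 0)) z -> fiber_julia (f 0) z w -> J (z, w).
Proof.
move=> Jz; apply: (julia2_sliceE (family_regular disk0) w _ Jz).2.
exact: (family_vertically_expanding disk0).
Qed.

(** Equality of first coordinates is carried from parameter 0 to [l] for one inclusion, and from [l]
    back to 0 for the other. *)
Lemma motion_preserves_fibration : preserves_vertical_fibration r f Phi.
Proof.
move=> l z Dl Jz.
have [w0 Jw0] := fiber_julia_nonempty (family_regular disk0)
  (julia_filled (family_regular disk0) Jz).
have Jx0 := fiber_julia_julia2 Jz Jw0.
(* Any point of the slice over [z] determines the target line, hence the need for a nonempty J_z. *)
exists (Phi l (z, w0)).1; first by apply: julia2_base; exact: motion_julia2.
rewrite eqEsubset; split.
  move=> _ [[a w] [Ja [/= az _]] <-]; split; first exact: motion_julia2.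
  split=> //=; apply: (motion_base_eq disk0 Dl Ja Jx0).
  by rewrite !motion0.
move=> y [Jy [/= yE _]]; have [_ /(_ l Dl)[im _]] := Phi_motion.
move: Jy yE; rewrite -im => -[x Jx <-] xE; exists x => //; split => //.
split=> //=; have := motion_base_eq Dl disk0 Jx Jx0 xE.
by rewrite !motion0.
Qed.

Lemma motion_fiber_julia z : julia (base (f 0)) z ->
  holomorphic_motion r (fiber_julia (f 0) z) (fun l w => (Phi l (z, w)).2).
Proof.
move=> Jz; have JJ w : fiber_julia (f 0) z w -> J (z, w) by exact: fiber_julia_julia2.
split.
- apply/subspace_continuousP => -[l w] [Dl Jw].
  set W := disk r `*` fiber_julia (f 0) z; pose F := within W (nbhs (l, w)).
  have FW : \forall t \near F, disk r t.1 /\ J (z, t.2).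
    by apply: filterS (withinT W (nbhs_filter (l, w))) => t [Dt Jt]; split=> //; exact: JJ.
  have hl : t.1 @[t --> F] --> l by apply: cvg_within_filter; exact: cvg_fst.
  have hw : t.2 @[t --> F] --> w by apply: cvg_within_filter; exact: cvg_snd.
  have hz : z @[_ --> F] --> z by exact: (@cvg_cst _ z _ F (within_filter _ _)).
  have h : Phi t.1 (z, t.2) @[t --> F] --> Phi l (z, w).
    exact: (@cvg_within_setX _ _ _ Phi (disk r) J _ F (within_filter _ _) fst
      (fun t => (z, t.2)) l (z, w) motion_continuous Dl (JJ _ Jw) hl (cvg_pair hz hw) FW).
  have k : (Phi t.1 (z, t.2)).2 @[t --> F] --> (Phi l (z, w)).2 := cvg_comp _ _ h cvg_snd.
  exact: k.
- by move=> w Jw; rewrite motion0//; exact: JJ.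
- move=> w Jw l Dl; have [[_ _ h _] _] := Phi_motion.
  have := h (z, w) (JJ _ Jw) l Dl; rewrite /derivable => hd.
  by apply: cvgP; exact: (cvg_comp _ _ hd cvg_snd).
- move=> l Dl w1 w2 /set_mem Jw1 /set_mem Jw2 e.
  (* Injectivity of the second coordinate alone comes from the preserved fibration: the first
     coordinates agree at parameter 0, hence at [l]. *)
  have e1 : (Phi l (z, w1)).1 = (Phi l (z, w2)).1.
    apply: (motion_base_eq disk0 Dl (JJ _ Jw1) (JJ _ Jw2)).
    by rewrite !motion0//; exact: JJ.
  have E : Phi l (z, w1) = Phi l (z, w2).
    by rewrite [LHS]surjective_pairing [RHS]surjective_pairing e e1.
  by have [] := motion_inj Dl (JJ _ Jw1) (JJ _ Jw2) E.
Qed.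

End MotionOfJ2.

Theorem theorem1p4 (R : realType) (f : cplx R -> poly_skew R)
    (f_hol : holomorphic_family f)
    (f_axiomA : forall l, disk 1 l -> axiomA (f l))
    (r : R) (r_gt0 : 0 < r) (r_le1 : r <= 1)
    (Phi : cplx R -> cplx R * cplx R -> cplx R * cplx R)
    (Phi_motion : julia2_motion r f Phi) :
  [/\ preserves_vertical_fibration r f Phi,
      (forall l z, disk r l -> julia (base (f l)) z ->
         [set z] `*` fiber_julia (f l) z = julia2 (f l) `&` vertical_line z) &
      (forall z, julia (base (f 0)) z ->
         holomorphic_motion r (fiber_julia (f 0) z)
           (fun l w => (Phi l (z, w)).2))].
Proof.
split.
- exact: motion_preserves_fibration.
- move=> l z Dl Jz; apply: julia2_slice Jz; first exact: (family_regular f_hol r_le1).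
  exact: (family_vertically_expanding f_axiomA r_le1).
- exact: motion_fiber_julia.
Qed.
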